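(* Let $E^{(1)},\dots,E^{(m)}$ be e-values, where each $E^{(j)}$ is a function of the local data $X^{(j)}$ and possibly of local randomness $U^{(j)}$, with $U^{(1)},\dots,U^{(m)}$ independent of each other and of the data. Let $C_m$ be either the average, $C_m(e)=m^{-1}\sum_{j=1}^m e_j$, or the product, $C_m(e)=\prod_{j=1}^m e_j$, and let $T_\alpha$ be the corresponding threshold test $$T_\alpha=\mathbf{1}\{C_m(E^{(1)},\dots,E^{(m)})\ge\alpha^{-1}\}.$$ If $C_m$ is the product, assume in addition that $\mathbb{E}_0|\log E^{(j)}|$ is uniformly bounded, say by $M>0$. Then there exists a constant $c>0$ (in the product case depending only on $M$; in the average case universal) such that for every $\alpha\in(0,0.1]$: if $$\rho^2\le c\,\frac{\big(\sqrt m\wedge\frac{d}{\log(m)}\big)\sqrt d}{mn},$$ then for all $n,m,d\in\mathbb{N}$, $\sup_{f\in H_\rho}\mathbb{P}_f(T_\alpha=0)\ge 3/4$. If instead the e-values are generated using shared randomness, i.e. each $E^{(j)}$ is a function of $X^{(j)}$ and of a common random variable $U$ independent of the data (the other assumptions being unchanged), then there exists a constant $c>0$ with the same dependence such that for every $\alpha\in(0,0.1]$: if $$\rho^2\le c\,\frac{\Big(\sqrt m\wedge\sqrt{\frac{d}{\log(m)}}\Big)\sqrt d}{mn},$$ then for all $n,m,d\in\mathbb{N}$, $\sup_{f\in H_\rho}\mathbb{P}_f(T_\alpha=0)>2/3$.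
   Context: Model: for $n,m,d\in\mathbb{N}$ and unknown $f\in\mathbb{R}^d$, one observes $X^{(j)}=f+\frac{1}{\sqrt n}Z^{(j)}$, with $Z^{(j)}$ i.i.d. $N(0,I_d)$, $j=1,\dots,m$. $\mathbb{P}_f$ and $\mathbb{E}_f$ denote the joint law (including auxiliary randomness, whose law does not depend on $f$) and expectation; $\mathbb{P}_0,\mathbb{E}_0$ correspond to $f=0$. For $\rho>0$, $H_\rho=\{f\in\mathbb{R}^d:\|f\|_2\ge\rho\}$; the null hypothesis is $f=0$. An e-value is a nonnegative random variable $E$ with $\mathbb{E}_0E\le1$. $a\wedge b=\min(a,b)$; for $m=1$, $d/\log(m)$ is read as $+\infty$.
   Formalization: For the product with shared randomness, it is additionally assumed that the product of the e-values has null expectation at most 1 (as holds if each is valid conditionally on U); without this the claim fails, e.g. for e-values depending only on U. *)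

(* Defs.v *)
From HB Require Import structures.
From mathcomp Require Import all_boot all_order all_algebra.
From mathcomp Require Import all_classical all_reals all_analysis.

Set Implicit Arguments.
Unset Strict Implicit.
Unset Printing Implicit Defensive.

Import Order.TTheory GRing.Theory Num.Theory.
Import numFieldNormedType.Exports.

Local Open Scope classical_set_scope.
Local Open Scope ring_scope.

Section gaussian_sequence_model.
Context {R : realType}.

(* [R^d] is [d.-tuple R], whose library sigma-algebra is the one generated by
   the coordinates, that is, the Borel one. *)

Definition zero_signal (d : nat) : d.-tuple R := [tuple 0 | i < d].

Definition l2norm (d : nat) (f : d.-tuple R) : R :=
  Num.sqrt (\sum_(i < d) tnth f i ^+ 2).

Definition H_ (d : nat) (rho : R) : set (d.-tuple R) :=
  [set f | rho <= l2norm f].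

Definition observation (n d : nat) (f z : d.-tuple R) : d.-tuple R :=
  [tuple tnth f i + (Num.sqrt n%:R)^-1 * tnth z i | i < d].

(* The boxes form a pi-system generating the Borel sets of R^d, so this
   identifies the law of [Z] with N(0, I_d). *)
Definition standard_gaussian (dO : measure_display) (Omega : measurableType dO)
    (P : probability Omega R) (d : nat) (Z : {RV P >-> d.-tuple R}) : Prop :=
  forall A : 'I_d -> set R, (forall i, measurable (A i)) ->
    P [set w | forall i, A i (tnth (Z w) i)] =
    (\prod_(i < d) normal_prob 0 1 (A i))%E.

(* All the variables [Y i] and [V j] together are mutually independent.  Taking
   some of the sets equal to [setT] gives the product rule for subfamilies. *)
Definition mutually_independent (dO : measure_display)
    (Omega : measurableType dO) (P : probability Omega R) (I J : finType)
    (dS : I -> measure_display) (S : forall i, measurableType (dS i))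
    (dT : J -> measure_display) (T : forall j, measurableType (dT j))
    (Y : forall i, {RV P >-> S i}) (V : forall j, {RV P >-> T j}) : Prop :=
  forall (A : forall i, set (S i)) (B : forall j, set (T j)),
    (forall i, measurable (A i)) -> (forall j, measurable (B j)) ->
    P [set w | (forall i, A i (Y i w)) /\ (forall j, B j (V j w))] =
    ((\prod_(i : I) P (Y i @^-1` A i)) * (\prod_(j : J) P (V j @^-1` B j)))%E.

(* To be used with the variable [E] evaluated on data drawn under [f = 0]. *)
Definition is_evalue (dO : measure_display) (Omega : measurableType dO)
    (P : probability Omega R) (E : Omega -> R) : Prop :=
  (forall w, 0 <= E w) /\ ('E_P[E] <= 1)%E.

(* E|log E|, with |log 0| = +oo. *)
Definition abs_log_moment (dO : measure_display) (Omega : measurableType dO)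
    (P : probability Omega R) (E : Omega -> R) : \bar R :=
  (\int[P]_w `| lne (E w)%:E |)%E.

Inductive combination : Set := average | product.

Definition combine (C : combination) (m : nat) (e : 'I_m -> R) : R :=
  match C with
  | average => m%:R^-1 * \sum_(j < m) e j
  | product => \prod_(j < m) e j
  end.

Definition threshold_test (alpha : R) (C : combination) (m : nat)
    (e : 'I_m -> R) : nat :=
  if alpha^-1 <= combine C e then 1%N else 0%N.

(* [E f j w] is the value of the j-th e-value when the signal is [f]; the noise
   and the auxiliary randomness live on a probability space independent of
   [f], so P_f (T_alpha = 0) is the [P]-probability of the event below. *)
Definition worst_type_II_error (dO : measure_display)
    (Omega : measurableType dO) (P : probability Omega R) (alpha : R)
    (C : combination) (m d : nat) (rho : R)
    (E : d.-tuple R -> 'I_m -> Omega -> R) : \bar R :=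
  ereal_sup
    [set P [set w | threshold_test alpha C (fun j => E f j w) = 0%N]
      | f in @H_ d rho].

(* [sqrt m /\ x], where [x] is d / log m or its square root, which is +oo for
   m = 1 (whereas [ln 1 = 0] and [_ / 0 = 0] in the library). *)
Definition sqrt_min (m : nat) (x : R) : R :=
  if m == 1%N then Num.sqrt m%:R else Num.min (Num.sqrt m%:R) x.

Definition local_rate (n m d : nat) : R :=
  sqrt_min m (d%:R / ln m%:R) * Num.sqrt d%:R / (m%:R * n%:R).

Definition shared_rate (n m d : nat) : R :=
  sqrt_min m (Num.sqrt (d%:R / ln m%:R)) * Num.sqrt d%:R / (m%:R * n%:R).

Definition local_randomness_bound (C : combination) (M c : R) : Prop :=
  forall (alpha : R) (n m d : nat) (rho : R),
    0 < alpha <= 10%:R^-1 ->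
    (0 < n)%N -> (0 < m)%N -> (0 < d)%N ->
    0 < rho -> rho ^+ 2 <= c * local_rate n m d ->
  forall (dO : measure_display) (Omega : measurableType dO)
    (P : probability Omega R)
    (Z : 'I_m -> {RV P >-> d.-tuple R})
    (dU : 'I_m -> measure_display) (TU : forall j, measurableType (dU j))
    (U : forall j, {RV P >-> TU j})
    (e : forall j, {mfun (d.-tuple R * TU j)%type >-> R}),
    let E f j w := e j (observation n f (Z j w), U j w) in
    (forall j, standard_gaussian (Z j)) ->
    mutually_independent Z U ->
    (forall j x, 0 <= e j x) ->
    (forall j, is_evalue P (E (zero_signal d) j)) ->
    (C = product -> forall j,
      (abs_log_moment P (E (zero_signal d) j) <= M%:E)%E) ->
  ((3 / 4)%:E <= worst_type_II_error P alpha C rho E)%E.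

(* E-values driven by a common [U] are independent only conditionally on [U],
   and their product need not have null expectation at most 1; that the product
   is an e-value is therefore a separate requirement here, whereas it is
   automatic for averages and for local randomness.  It holds in particular
   when each e-value is valid conditionally on [U].  Without it the conclusion
   fails: take [e j (x, u) = g u] with [g U] equal to 1 + eps with probability
   close to 1 and E(g U) <= 1, and [m] large. *)
Definition shared_randomness_bound (C : combination) (M c : R) : Prop :=
  forall (alpha : R) (n m d : nat) (rho : R),
    0 < alpha <= 10%:R^-1 ->
    (0 < n)%N -> (0 < m)%N -> (0 < d)%N ->
    0 < rho -> rho ^+ 2 <= c * shared_rate n m d ->
  forall (dO : measure_display) (Omega : measurableType dO)
    (P : probability Omega R)
    (Z : 'I_m -> {RV P >-> d.-tuple R})
    (dU : measure_display) (TU : measurableType dU) (U : {RV P >-> TU})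
    (e : 'I_m -> {mfun (d.-tuple R * TU)%type >-> R}),
    let E f j w := e j (observation n f (Z j w), U w) in
    (forall j, standard_gaussian (Z j)) ->
    mutually_independent Z (fun _ : unit => U) ->
    (forall j x, 0 <= e j x) ->
    (forall j, is_evalue P (E (zero_signal d) j)) ->
    (C = product -> forall j,
      (abs_log_moment P (E (zero_signal d) j) <= M%:E)%E) ->
    (C = product ->
      is_evalue P (fun w => combine C (fun j => E (zero_signal d) j w))) ->
  ((2 / 3)%:E < worst_type_II_error P alpha C rho E)%E.

End gaussian_sequence_model.

(* Main.v *)
Require Import Defs.
From HB Require Import structures.
From mathcomp Require Import all_boot all_order all_algebra.
From mathcomp Require Import all_classical all_reals all_analysis.
From mathcomp Require Import measurable_realfun.
From mathcomp Require Import ring lra.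

Set Implicit Arguments.
Unset Strict Implicit.
Unset Printing Implicit Defensive.

Import Order.TTheory GRing.Theory Num.Theory.
Import numFieldNormedType.Exports.

Local Open Scope classical_set_scope.
Local Open Scope ring_scope.

(* Take the prior that is uniform on the signals with coordinates
   [+- rho / sqrt d], and let [L] be the likelihood ratio of one machine under
   this mixture.  For [rho ^ 2 <= c sqrt m sqrt d / (m n)] its third moment is
   [1 + O(c ^ 2 / m)], and one machine contributes linearly:
   - for the average, truncating the e-values at [10 m] does not affect the test
     and the mixture mean of each truncated e-value is at most [5 / 2], so
     Markov's inequality applies;
   - for the product with local randomness, [E^(2/3)] has mixture mean at most
     [1 + O(c ^ 2 / m)] by [3 l y ^ 2 <= 2 y ^ 3 + l ^ 3].  Choosing one signal
     for which the sum over the machines is at most its average, independence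
     and [1 + x <= exp x] bound the mean of the product of the [E^(2/3)] by
     [1 + O(c ^ 2)].
   For the product with a common [U] the signal cannot be chosen before
   averaging over [U].  Given [U], the prior average of the product over the
   machines of the means of [sqrt E] is bounded by hypercontractivity: the
   likelihood ratios of the signals with signs [s] and [t] have second moment
   [exp (b <s, t>)], [b = n rho ^ 2 / d], and this kernel maps [L^(1 + 1/m)] to its dual
   with norm at most [cosh b ^ d] as soon as [b <= c / m]. *)

(** The exponents come from the levels. For [alpha <= 1/10], Markov's inequality for the power [p]
    of the product costs a factor [10^(-p)]. At [p = 2/3] this is below [1/4], and Young's
    inequality pairs [p = 2/3] with the third moment of [L]. At [p = 1/2] it is only below [1/3],
    which suffices for the level [2/3]; in exchange, Cauchy-Schwarz turns means of [sqrt E] into a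
    quadratic form in the second-moment kernel.

    The obstacle with a common [U] is that, even for fixed [U], the machines are independent given
    the signal but not under the mixture. The prior average of a product of [m] functions on the
    cube has to be controlled uniformly in [m]. AM-GM over the normalized functions and the constant
    1 leaves a single power [Y^(m+1)], and testing duality with [Y^m] produces the exponent
    [1 + 1/m]; the added constant keeps it in [(1, 2]] even for [m = 1]. The product of conditional
    null means that remains is the conditional null mean of the product of the e-values, and its
    average over [U] is at most 1. *)

Section powers.
Context {R : realType}.
Implicit Types a b p q t x y : R.

(** For [t > 0], write the power as [t exp((p - 1) ln t)] and use [exp x >= 1 + x]. The gain is
    linear in [p - 1], with the entropy term [t ln t] as coefficient. *)
Lemma powR_ge_tangent p t : 1 <= p -> 0 <= t ->
  t + (p - 1) * (t * ln t) <= t `^ p.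
Proof.
move=> p1; rewrite le_eqVlt => /predU1P[<-|t0].
  by rewrite mul0r mulr0 addr0 powR_ge0.
have -> : t `^ p = t * expR ((p - 1) * ln t).
  transitivity (expR (ln t) * expR ((p - 1) * ln t)); last by rewrite lnK ?posrE.
  rewrite /powR gt_eqF// -expRD.
  by congr expR; ring.
rewrite mulrCA -[X in X + _]mulr1 -mulrDr ler_pM2l//.
exact: expR_ge1Dx.
Qed.

Lemma xlnx_ge t : 0 <= t -> t - 1 <= t * ln t.
Proof.
rewrite le_eqVlt => /predU1P[<-|t0]; first by lra.
have := @expR_ge1Dx R (- ln t); rewrite expRN lnK ?posrE// => h.
have := ler_wpM2l (ltW t0) h; rewrite divff ?gt_eqF//; lra.
Qed.

(** With [s = sqrt t], [xlnx_ge] at [s] gives [t ln t >= 2 s (s - 1) = t - 1 + (1 - s)^2], and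
    [(1 - t)^2 <= 4 (1 - s)^2] because [1 + s <= 2]. *)
Lemma xlnx_ge_sqr t : 0 <= t <= 1 -> t - 1 + (1 - t) ^+ 2 / 4 <= t * ln t.
Proof.
move=> /andP[]; rewrite le_eqVlt => /predU1P[<- _|t0 t1]; first by lra.
have s0 : 0 < Num.sqrt t by rewrite sqrtr_gt0.
set s := Num.sqrt t in s0 *; have ts : t = s ^+ 2 by rewrite sqr_sqrtr// ltW.
have s1 : s <= 1 by rewrite -[leRHS](sqrtr1) ler_sqrt.
have h := xlnx_ge (ltW s0).
rewrite ts lnXn// mulr2n.
have h1 : (1 - s) ^+ 2 * (1 + s) ^+ 2 <= (1 - s) ^+ 2 * 4.
  by rewrite ler_wpM2l ?sqr_ge0//; nra.
have := ler_wpM2l (ltW s0) h; nra.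
Qed.

Lemma powR_ge_bernoulli p t : 1 <= p -> 0 <= t -> 1 + p * (t - 1) <= t `^ p.
Proof.
move=> p1 t0; have := powR_ge_tangent p1 t0; have := xlnx_ge t0; nra.
Qed.

(** In the sum of the two tangent bounds the entropy terms contribute at least [x] and
    [- x + x^2 / 4]. The linear parts cancel and the mean of the powers is at least
    [1 + (p - 1) x^2 / 8], whence the constant 8. This mean is at least 1, so the outer power
    [2 / p >= 1] can only increase it. *)
Lemma two_point_normalized p x : 1 <= p <= 2 -> 0 <= x <= 1 ->
  1 + (p - 1) / 8 * x ^+ 2 <= (((1 + x) `^ p + (1 - x) `^ p) / 2) `^ (2 / p).
Proof.
move=> /andP[p1 p2] /andP[x0 x1].
have h1 : 0 <= 1 + x by lra.
have h2 : 0 <= 1 - x by lra.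
have h3 : 0 <= 1 - x <= 1 by lra.
have e1 := powR_ge_tangent p1 h1; have e2 := powR_ge_tangent p1 h2.
have e3 := xlnx_ge h1; have e4 := xlnx_ge_sqr h3.
set M := (_ + _) / 2.
have M1 : 1 + (p - 1) / 8 * x ^+ 2 <= M.
  by rewrite /M; nra.
have M1' : 1 <= M.
  by apply: le_trans M1; rewrite lerDl mulr_ge0 ?sqr_ge0//; lra.
have M0 : 0 <= M by lra.
have r1 : 1 <= 2 / p by rewrite ler_pdivlMr; lra.
apply: le_trans (powR_ge_bernoulli r1 M0).
apply: (le_trans M1).
have : 0 <= (2 / p - 1) * (M - 1) by apply: mulr_ge0; lra.
lra.
Qed.

(* Hypercontractivity on two points, with a constant that is not optimal. *)
Lemma two_point p a b : 1 <= p <= 2 -> 0 <= a -> 0 <= b ->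
  ((a + b) / 2) ^+ 2 + (p - 1) / 8 * ((a - b) / 2) ^+ 2 <=
  ((a `^ p + b `^ p) / 2) `^ (2 / p).
Proof.
move=> p12; wlog ba : a b / b <= a => [H a0 b0|a0 b0].
  have [ba|/ltW ab] := leP b a; first exact: H.
  rewrite (addrC a b) -(sqrrN ((a - b) / 2)) -mulNr opprB (addrC (a `^ p)).
  exact: H.
have [a00|an0] := eqVneq a 0.
  have -> : b = 0 by lra.
  rewrite a00.
  by rewrite !addr0 subr0 mul0r expr0n/= mulr0 addr0 powR_ge0.
have a_gt0 : 0 < a by rewrite lt0r an0.
set u := (a + b) / 2; have u0 : 0 < u by rewrite /u; lra.
(* Both sides are homogeneous of degree 2: dividing by the mean [u] leaves [1 + x] and [1 - x], and
   [b <= a] gives [0 <= x <= 1]. *)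
pose x := (a - b) / (a + b).
have x01 : 0 <= x <= 1.
  by rewrite /x divr_ge0 ?ler_pdivrMr//; lra.
have ab0 : a + b != 0 by rewrite gt_eqF//; lra.
have ax : a = u * (1 + x) by rewrite /u /x; field.
have bx : b = u * (1 - x) by rewrite /u /x; field.
have vx : (a - b) / 2 = u * x by rewrite /u /x; field.
have x1 : 0 <= 1 + x by move: x01; lra.
have x2 : 0 <= 1 - x by move: x01; lra.
rewrite vx ax bx (powRM _ (ltW u0) x1) (powRM _ (ltW u0) x2) -mulrDr -(mulrA (u `^ p)).
have M0 : 0 <= ((1 + x) `^ p + (1 - x) `^ p) / 2.
  by rewrite divr_ge0// addr_ge0// powR_ge0.
rewrite (powRM _ (powR_ge0 u p) M0) -powRrM (mulrC p) divfK; last first.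
  by rewrite gt_eqF//; lra.
have -> : u ^+ 2 + (p - 1) / 8 * (u * x) ^+ 2 =
    u ^+ 2 * (1 + (p - 1) / 8 * x ^+ 2) by ring.
rewrite powR_mulrn ?(ltW u0)//.
by rewrite ler_pM2l ?exprn_gt0// two_point_normalized.
Qed.

End powers.

(** * Averages over the sign cube and hypercontractivity *)

Fixpoint cube (d : nat) : finType :=
  if d is d'.+1 then (bool * cube d')%type : finType else unit.

(** Signs are nested pairs indexed by plain naturals: splitting off the first sign is then a matter
    of computation, and both the factorization of averages and the tensorization below are
    inductions on [d]. *)
Fixpoint bit (d : nat) : cube d -> nat -> bool :=
  if d is d'.+1 then
    fun s i => if i is i'.+1 then bit s.2 i' else s.1
  else fun _ _ => false.

Section cube.
Context {R : realType}.

Definition cube_avg (d : nat) (F : cube d -> R) : R :=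
  (2 ^+ d)^-1 * \sum_(s : cube d) F s.

Lemma cube_avg0 (F : cube 0 -> R) : cube_avg F = F tt.
Proof.
rewrite /cube_avg expr0 invr1 mul1r (bigD1 tt)//= big1 ?addr0//.
Qed.

Lemma cube_avgS d (F : cube d.+1 -> R) : cube_avg F =
  (cube_avg (fun s => F (true, s)) + cube_avg (fun s => F (false, s))) / 2.
Proof.
rewrite /cube_avg; have -> : \sum_(s : cube d.+1) F s =
    \sum_(b : bool) \sum_(s : cube d) F (b, s).
  by rewrite pair_bigA; apply: eq_bigr => -[].
rewrite big_bool/=.
by rewrite exprS invfM; ring.
Qed.

Lemma eq_cube_avg d (F G : cube d -> R) : F =1 G -> cube_avg F = cube_avg G.
Proof. by move=> FG; congr (_ * _); exact: eq_bigr. Qed.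

Lemma cube_avgD d (F G : cube d -> R) :
  cube_avg (fun s => F s + G s) = cube_avg F + cube_avg G.
Proof. by rewrite /cube_avg big_split mulrDr. Qed.

Lemma cube_avgZ d k (F : cube d -> R) :
  cube_avg (fun s => k * F s) = k * cube_avg F.
Proof. by rewrite /cube_avg -big_distrr/= mulrCA. Qed.

Lemma cube_avg_sum d (I : finType) (F : I -> cube d -> R) :
  cube_avg (fun s => \sum_i F i s) = \sum_i cube_avg (F i).
Proof. by rewrite /cube_avg exchange_big/= -big_distrr. Qed.

Lemma cube_avg_cst d k : cube_avg (fun _ : cube d => k) = k.
Proof.
elim: d => [|d IH]; first by rewrite cube_avg0.
by rewrite cube_avgS IH; field.
Qed.

Lemma le_cube_avg d (F G : cube d -> R) :
  (forall s, F s <= G s) -> cube_avg F <= cube_avg G.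
Proof.
by move=> FG; rewrite ler_wpM2l ?invr_ge0 ?exprn_ge0//; exact: ler_sum.
Qed.

Lemma cube_avg_ge0 d (F : cube d -> R) :
  (forall s, 0 <= F s) -> 0 <= cube_avg F.
Proof. by move=> F0; rewrite -[leLHS](cube_avg_cst d) le_cube_avg. Qed.

Lemma cube_avg_exists d (F : cube d -> R) : exists s, F s <= cube_avg F.
Proof.
elim: d F => [|d IH] F; first by exists tt; rewrite cube_avg0.
have [[s Fs] [t Ft]] := (IH (fun s => F (true, s)), IH (fun s => F (false, s))).
rewrite cube_avgS; case: (leP (F (true, s)) (F (false, t))) => h.
  by exists (true, s); lra.
by exists (false, t); lra.
Qed.

Lemma cube_avg_prod d (F : nat -> bool -> R) :
  cube_avg (fun s : cube d => \prod_(i < d) F i (bit s i)) =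
  \prod_(i < d) ((F i true + F i false) / 2).
Proof.
elim: d F => [|d IH] F; first by rewrite cube_avg0 !big_ord0.
rewrite cube_avgS big_ord_recl/= -(IH (fun i => F i.+1)).
under eq_cube_avg do rewrite big_ord_recl/=.
rewrite cube_avgZ; under [in X in _ + X]eq_cube_avg do rewrite big_ord_recl/=.
by rewrite cube_avgZ; ring.
Qed.

Lemma cube_avg_eq0 d (F : cube d -> R) :
  (forall s, 0 <= F s) -> cube_avg F = 0 -> forall s, F s = 0.
Proof.
move=> F0 /eqP; rewrite mulf_eq0 invr_eq0 expf_eq0/= (_ : _ == 0 :> R = false).
  rewrite andbF/= => /eqP/psumr_eq0P h s; exact: h.
by apply/negbTE; rewrite pnatr_eq0.
Qed.

Section hypercontractivity.
Variables (kp km p : R).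
Hypothesis p12 : 1 <= p <= 2.
Hypothesis km0 : 0 <= km.
Hypothesis kmp : km <= kp.
Hypothesis kp_km : kp - km <= (p - 1) / 8 * (kp + km).

(** For [kp = exp b] and [km = exp (- b)] the product over the coordinates is [exp (b <s, t>)], the
    second-moment kernel of the likelihood ratios. *)
Definition sign_kernel (x y : bool) : R := if x == y then kp else km.

Definition cube_form (d : nat) (q r : cube d -> R) : R :=
  cube_avg (fun s => cube_avg (fun t =>
    q s * r t * \prod_(i < d) sign_kernel (bit s i) (bit t i))).

Definition cube_norm (d : nat) (q : cube d -> R) : R :=
  cube_avg (fun s => q s `^ p) `^ p^-1.

Let p_gt0 : 0 < p. Proof. by move: p12; lra. Qed.

Lemma cube_norm_ge0 d (q : cube d -> R) : 0 <= cube_norm q.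
Proof. exact: powR_ge0. Qed.

Lemma cube_normX d (q : cube d -> R) :
  cube_norm q `^ p = cube_avg (fun s => q s `^ p).
Proof.
rewrite /cube_norm -powRrM mulVf ?gt_eqF// powRr1// cube_avg_ge0// => s.
exact: powR_ge0.
Qed.

Let norm2 (a b : R) := ((a `^ p + b `^ p) / 2) `^ p^-1.

Let two_point2 (a b : R) : 0 <= a -> 0 <= b ->
  ((a + b) / 2) ^+ 2 + (p - 1) / 8 * ((a - b) / 2) ^+ 2 <= norm2 a b ^+ 2.
Proof.
move=> a0 b0. apply: (le_trans (two_point p12 a0 b0)).
by rewrite /norm2 -(powR_mulrn 2) ?powR_ge0// -powRrM (mulrC 2).
Qed.

(** In the coordinates mean and half-difference the kernel is diagonal, with coefficients
    [(kp + km) / 2] and [(kp - km) / 2]. By [kp_km] the second is at most [(p - 1) / 8] times the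
    first, so Cauchy-Schwarz for the two instances of [two_point2] absorbs it. *)
Let two_point_bilinear (a b a' b' : R) :
  0 <= a -> 0 <= b -> 0 <= a' -> 0 <= b' ->
  (kp * (a * a' + b * b') + km * (a * b' + b * a')) / 4 <=
  (kp + km) / 2 * (norm2 a b * norm2 a' b').
Proof.
move=> a0 b0 a'0 b'0.
have h := two_point2 a0 b0; have h' := two_point2 a'0 b'0.
have N0 : 0 <= norm2 a b by exact: powR_ge0.
have N0' : 0 <= norm2 a' b' by exact: powR_ge0.
move: (norm2 a b) (norm2 a' b') N0 N0' h h' => N N' N0 N0'.
set u := (a + b) / 2; set v := (a - b) / 2.
set u' := (a' + b') / 2; set v' := (a' - b') / 2.
have -> : (kp * (a * a' + b * b') + km * (a * b' + b * a')) / 4 =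
   (kp + km) / 2 * (u * u') + (kp - km) / 2 * (v * v').
  by rewrite /u /u' /v /v'; field.
move=> h h'; have kt := kp_km; set t := (p - 1) / 8 in h h' kt *.
have t0 : 0 <= t by rewrite /t; move: p12; lra.
have u0 : 0 <= u by rewrite /u; lra.
have u'0 : 0 <= u' by rewrite /u'; lra.
have CS : u * u' + t * (`|v| * `|v'|) <= N * N'.
  have L0 : 0 <= u * u' + t * (`|v| * `|v'|).
    by apply: addr_ge0; [exact: mulr_ge0|apply: mulr_ge0 => //; exact: mulr_ge0].
  have M0 : 0 <= N * N' by rewrite mulr_ge0.
  rewrite -(ler_sqr L0 M0) (exprMn 2 N).
  have e2 : 0 <= N ^+ 2 by exact: sqr_ge0.
  have e3 : 0 <= u' ^+ 2 + t * v' ^+ 2 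
    by apply: addr_ge0; [exact: sqr_ge0|apply: mulr_ge0 => //; exact: sqr_ge0].
  apply: le_trans (ler_wpM2l e2 h'); apply: le_trans (ler_wpM2r e3 h).
  rewrite -(real_normK (num_real v)) -(real_normK (num_real v')).
  (* Lagrange's identity for the defect in Cauchy-Schwarz. *)
  rewrite -subr_ge0 (_ : _ - _ = t * (u * `|v'| - u' * `|v|) ^+ 2); last by ring.
  by rewrite mulr_ge0 ?sqr_ge0.
have : (kp - km) / 2 * (v * v') <= (kp + km) / 2 * (t * (`|v| * `|v'|)).
  apply: (@le_trans _ _ ((kp - km) / 2 * (`|v| * `|v'|))).
    by rewrite -normrM ler_wpM2l ?ler_norm//; move: kmp; lra.
  rewrite [leRHS]mulrA ler_wpM2r ?mulr_ge0//; move: kt; lra.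
have : (kp + km) / 2 * (u * u' + t * (`|v| * `|v'|)) <= (kp + km) / 2 * (N * N').
  by rewrite ler_wpM2l//; move: km0 kmp; lra.
rewrite mulrDr; lra.
Qed.

(** Tensorization: splitting off the first sign writes the form as four forms of slices with
    nonnegative coefficients. The induction hypothesis replaces each by a product of norms of
    slices, to which the two-point inequality applies, since the norm on the larger cube is the
    two-point norm of the slice norms. *)
Theorem hypercontractivity d (q r : cube d -> R) :
  (forall s, 0 <= q s) -> (forall s, 0 <= r s) ->
  cube_form q r <= ((kp + km) / 2) ^+ d * (cube_norm q * cube_norm r).
Proof.
elim: d q r => [|d IH] q r q0 r0.
  rewrite /cube_form /cube_norm !cube_avg0 big_ord0 mulr1 expr0 mul1r.
  by rewrite -!powRrM mulfV ?gt_eqF// !powRr1.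
pose h (f : cube d.+1 -> R) (b : bool) := fun s : cube d => f (b, s).
have normS (f : cube d.+1 -> R) : cube_norm f =
    norm2 (cube_norm (h f true)) (cube_norm (h f false)).
  rewrite {1}/cube_norm cube_avgS.
  by congr (((_ + _) / 2) `^ _); apply/esym; exact: cube_normX.
have formS : cube_form q r =
    (kp * (cube_form (h q true) (h r true) + cube_form (h q false) (h r false)) +
     km * (cube_form (h q true) (h r false) + cube_form (h q false) (h r true))) / 4.
  have E b b' : cube_avg (fun s => cube_avg (fun t => q (b, s) * r (b', t) *
      \prod_(i < d.+1) sign_kernel (bit ((b, s) : cube d.+1) i) (bit ((b', t) : cube d.+1) i))) =
      sign_kernel b b' * cube_form (h q b) (h r b').
    rewrite /cube_form -cube_avgZ; apply: eq_cube_avg => s.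
    rewrite -cube_avgZ; apply: eq_cube_avg => t.
    by rewrite big_ord_recl/= mulrCA.
  rewrite [LHS]/cube_form cube_avgS.
  under eq_cube_avg do rewrite cube_avgS.
  under [X in _ + X]eq_cube_avg do rewrite cube_avgS.
  under eq_cube_avg do rewrite mulrC.
  under [X in _ + X]eq_cube_avg do rewrite mulrC.
  rewrite !cube_avgZ !cube_avgD !E /sign_kernel/=; by field.
have h0 (f : cube d.+1 -> R) b : (forall s, 0 <= f s) -> forall s, 0 <= h f b s.
  by move=> f0 s; exact: f0.
have kpm : 0 <= (kp + km) / 2 by move: km0 kmp; lra.
rewrite formS [in leRHS]normS [in X in _ <= _ * (_ * X)]normS exprSr -mulrA.
apply: (@le_trans _ _ (((kp + km) / 2) ^+ d *
    ((kp * (cube_norm (h q true) * cube_norm (h r true) +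
            cube_norm (h q false) * cube_norm (h r false)) +
      km * (cube_norm (h q true) * cube_norm (h r false) +
            cube_norm (h q false) * cube_norm (h r true))) / 4))); last first.
  rewrite ler_wpM2l ?exprn_ge0//.
  by apply: two_point_bilinear; exact: cube_norm_ge0.
rewrite mulrA ler_pM2r//.
have kp0 : 0 <= kp by move: km0 kmp; lra.
have combine_le (K x1 x2 x3 x4 y1 y2 y3 y4 : R) :
    x1 <= K * y1 -> x2 <= K * y2 -> x3 <= K * y3 -> x4 <= K * y4 ->
    kp * (x1 + x2) + km * (x3 + x4) <= K * (kp * (y1 + y2) + km * (y3 + y4)).
  move=> h1 h2 h3 h4.
  rewrite (_ : K * _ = kp * (K * y1 + K * y2) + km * (K * y3 + K * y4)); last by ring.
  by apply: lerD; apply: ler_wpM2l => //; apply: lerD.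
by apply: combine_le; apply: IH; exact: h0.
Qed.

End hypercontractivity.
End cube.

(** * Prior averages of products of functions on the cube *)

Section moments.
Context {R : realType}.

Section moment.
Variables (kp km : R) (m : nat).
Hypothesis m0 : (0 < m)%N.
Hypothesis km0 : 0 <= km.
Hypothesis kmp : km <= kp.
Hypothesis kp_km : kp - km <= m%:R^-1 / 8 * (kp + km).

(* A duality argument: test the assumption with [q = G ^ m]. *)
Lemma cube_avg_moment d (G : cube d -> R) :
  (forall s, 0 <= G s) ->
  (forall q : cube d -> R, (forall s, 0 <= q s) ->
     cube_avg (fun s => q s * G s) ^+ 2 <= cube_form kp km q q) ->
  cube_avg (fun s => G s ^+ m.+1) ^+ 2 <= ((kp + km) / 2) ^+ (d * m.+1).
Proof.
move=> G0 HG; set A := cube_avg _; set K := (kp + km) / 2.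
have mR0 : 0 < m%:R :> R by rewrite ltr0n.
have im1 : m%:R^-1 <= 1 :> R by rewrite invf_le1// ler1n.
have K0 : 0 <= K by rewrite /K; move: km0 kmp; lra.
have A0 : 0 <= A by apply: cube_avg_ge0 => s; exact: exprn_ge0.
have [->|An0] := eqVneq A 0; first by rewrite expr0n exprn_ge0.
have A_gt0 : 0 < A by rewrite lt0r An0.
pose p : R := 1 + m%:R^-1.
have p0 : 0 < p by rewrite /p addr_gt0// invr_gt0.
have p12 : 1 <= p <= 2.
  by rewrite /p lerDl invr_ge0 ltW//=; lra.
have qX s : (G s ^+ m) `^ p = G s ^+ m.+1.
  rewrite -powR_mulrn// -powRrM -powR_mulrn//; congr (_ `^ _).
  by rewrite /p mulrDr mulr1 mulfV ?gt_eqF// -natr1.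
have kp_km' : kp - km <= (p - 1) / 8 * (kp + km) by rewrite /p (addrC 1) addrK.
have q0 s : 0 <= G s ^+ m by exact: exprn_ge0.
have h1 := HG _ q0.
have h2 := hypercontractivity p12 km0 kmp kp_km' q0 q0.
have := le_trans h1 h2; rewrite -/K.
under eq_cube_avg do rewrite -exprSr.
rewrite -/A -expr2.
have N0 := cube_norm_ge0 p (fun s => G s ^+ m).
(* The norm is [A] to the power [1 / p = m / (m + 1)]. Raising [A^2 <= K^d N^2] to the power [m + 1]
   therefore gives [A^(2m+2) <= K^(d(m+1)) A^(2m)], from which [A^(2m)] cancels. *)
have NX : cube_norm p (fun s => G s ^+ m) ^+ m.+1 = A ^+ m.
  rewrite /cube_norm; under eq_cube_avg do rewrite qX.
  rewrite -/A -!powR_mulrn// -?powRrM ?powR_ge0//; congr (_ `^ _).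
  rewrite -natr1 /p; field.
  by rewrite natr1 pnatr_eq0 pnatr_eq0 -lt0n m0.
move=> h3.
have h4 : (A ^+ 2) ^+ m.+1 <= (K ^+ d * cube_norm p (fun s => G s ^+ m) ^+ 2) ^+ m.+1.
  rewrite lerXn2r ?nnegrE//; first exact: sqr_ge0.
  by apply: mulr_ge0; [exact: exprn_ge0|exact: sqr_ge0].
move: h4; set N := cube_norm _ _ in NX *.
have -> : (K ^+ d * N ^+ 2) ^+ m.+1 = K ^+ (d * m.+1) * (A ^+ m) ^+ 2.
  by rewrite -NX exprMn -!exprM (mulnC 2).
have -> : (A ^+ 2) ^+ m.+1 = A ^+ 2 * (A ^+ m) ^+ 2.
  by rewrite exprS -!exprM (mulnC m).
by rewrite ler_pM2r// !exprn_gt0.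
Qed.

(** After division by [sqrt (r j)] every [G j], and by the first hypothesis on [q] also the constant
    1, defines a functional on nonnegative [q] bounded by the square root of the form. This bound
    passes to the arithmetic mean [Y] of these functions, whose power [m + 1] dominates their
    product. *)
Lemma cube_avg_prod_le d (G : 'I_m -> cube d -> R) (r : 'I_m -> R) :
  (forall j s, 0 <= G j s) -> (forall j, 0 <= r j) ->
  (forall q : cube d -> R, (forall s, 0 <= q s) ->
     cube_avg q ^+ 2 <= cube_form kp km q q) ->
  (forall j (q : cube d -> R), (forall s, 0 <= q s) ->
     cube_avg (fun s => q s * G j s) ^+ 2 <= r j * cube_form kp km q q) ->
  cube_avg (fun s => \prod_j G j s) ^+ 2 <=
  ((kp + km) / 2) ^+ (d * m.+1) * \prod_j r j.
Proof.
move=> G0 r0 H1 HG.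
have K0 : 0 <= (kp + km) / 2 by move: km0 kmp; lra.
(* If some [r j] vanishes, normalization is impossible, but testing with [q = 1] shows that [G j]
   vanishes identically. *)
have [/existsP[j /eqP rj0]|/existsPn rn0] := boolP [exists j, r j == 0].
  have Gj0 : forall s, G j s = 0.
    apply: cube_avg_eq0 => //.
    have := HG j (fun=> 1) (fun=> ler01); rewrite rj0 mul0r.
    under eq_cube_avg do rewrite mul1r.
    by move=> h; apply/eqP; rewrite -sqrf_eq0 eq_le h sqr_ge0.
  rewrite (_ : cube_avg _ = 0); last first.
    rewrite (@eq_cube_avg _ _ _ (fun=> 0)) ?cube_avg_cst// => s.
    by rewrite (bigD1 j)//= Gj0 mul0r.
  by rewrite expr0n/= mulr_ge0 ?exprn_ge0// prodr_ge0.
have r_gt0 j : 0 < r j by rewrite lt0r rn0 r0.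
pose X j s := G j s / Num.sqrt (r j).
have X0 j s : 0 <= X j s by rewrite divr_ge0// sqrtr_ge0.
pose Y s := (1 + \sum_j X j s) / m.+1%:R.
have Y0 s : 0 <= Y s by rewrite divr_ge0// addr_ge0// sumr_ge0.
have prodXY s : \prod_j X j s <= Y s ^+ m.+1.
  (* The index [ord0] carries the constant 1, so that AM-GM is over [m + 1] factors. *)
  pose F (i : 'I_m.+1) := if unlift ord0 i is Some j then X j s else 1.
  have F0 : {in 'I_m.+1, forall i, 0 <= F i}.
    by move=> i _; rewrite /F; case: unliftP.
  have [] := leif_AGM F0; rewrite card_ord.
  rewrite (eq_bigl xpredT)// [X in (X / _) ^+ _](eq_bigl xpredT)//.
  rewrite !big_ord_recl/= /F unlift_none mul1r => + _.
  under eq_bigr do rewrite liftK.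
  by under [in X in _ <= X -> _]eq_bigr do rewrite liftK.
have form0 q : (forall s, 0 <= q s) -> 0 <= cube_form kp km q q.
  move=> q0; apply: cube_avg_ge0 => s; apply: cube_avg_ge0 => t.
  rewrite mulr_ge0 ?mulr_ge0// prodr_ge0// => i _.
  by rewrite /sign_kernel; case: ifP => _ //; exact: le_trans kmp.
have sqrt_bound q j : (forall s, 0 <= q s) ->
    cube_avg (fun s => q s * X j s) <= Num.sqrt (cube_form kp km q q).
  move=> q0; have sr0 : 0 < Num.sqrt (r j) by rewrite sqrtr_gt0.
  have qG0 : 0 <= cube_avg (fun s => q s * G j s).
    by apply: cube_avg_ge0 => s; rewrite mulr_ge0.
  have -> : cube_avg (fun s => q s * X j s) =
      (Num.sqrt (r j))^-1 * cube_avg (fun s => q s * G j s).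
    by rewrite -cube_avgZ; apply: eq_cube_avg => s; rewrite /X mulrA mulrC.
  rewrite ler_pdivrMl// -sqrtrM ?r0// -(ger0_norm qG0) -sqrtr_sqr ler_sqrt.
    exact: HG.
  by rewrite mulr_ge0 ?form0.
have HY q : (forall s, 0 <= q s) ->
    cube_avg (fun s => q s * Y s) ^+ 2 <= cube_form kp km q q.
  move=> q0; set B := cube_form _ _ _ _.
  have B0 : 0 <= B by exact: form0.
  rewrite -(sqr_sqrtr B0) lerXn2r ?nnegrE ?sqrtr_ge0//.
    by apply: cube_avg_ge0 => s; rewrite mulr_ge0.
  have -> : cube_avg (fun s => q s * Y s) =
      m.+1%:R^-1 * (cube_avg q + \sum_j cube_avg (fun s => q s * X j s)).
    rewrite -cube_avg_sum -cube_avgD -cube_avgZ; apply: eq_cube_avg => s.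
    by rewrite /Y -big_distrr/=; ring.
  rewrite ler_pdivrMl ?ltr0n// -nat1r mulrDl mul1r lerD//.
    rewrite -[leLHS]ger0_norm ?cube_avg_ge0// -sqrtr_sqr ler_sqrt//.
    exact: H1.
  rewrite -[X in X%:R * _](card_ord m) mulr_natl -sumr_const.
  by apply: ler_sum => j _; exact: sqrt_bound.
have := cube_avg_moment Y0 HY.
have XY : cube_avg (fun s => \prod_j X j s) <= cube_avg (fun s => Y s ^+ m.+1).
  exact: le_cube_avg.
have XG : cube_avg (fun s => \prod_j G j s) ^+ 2 =
    cube_avg (fun s => \prod_j X j s) ^+ 2 * \prod_j r j.
  have -> : \prod_j r j = (\prod_j Num.sqrt (r j)) ^+ 2.
    by rewrite -prodrXl; apply: eq_bigr => j _; rewrite sqr_sqrtr.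
  rewrite -exprMn mulrC -cube_avgZ; congr (_ ^+ 2); apply: eq_cube_avg => s.
  rewrite -big_split/=; apply: eq_bigr => j _.
  by rewrite /X mulrCA mulfV ?mulr1// gt_eqF// sqrtr_gt0.
move=> h; rewrite XG ler_wpM2r ?prodr_ge0//; apply: le_trans h.
rewrite lerXn2r// nnegrE; apply: cube_avg_ge0 => s.
  by rewrite prodr_ge0.
by rewrite exprn_ge0.
Qed.

End moment.
End moments.

(** * Numerical consequences of the rates, in terms of [b = n rho^2 / d] *)

Section rates.
Context {R : realType}.
Implicit Types (b c x : R) (n m d : nat).

(** From [exp (- x) >= 1 - x] and [(1 + x + 2 x^2) (1 - x) = 1 + x^2 (1 - 2 x) >= 1]. *)
Lemma expR_le_quadratic x : x <= 1 / 2 -> expR x <= 1 + x + 2 * x ^+ 2.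
Proof.
move=> x12; have := expR_ge1Dx (- x); rewrite expRN => h.
have e0 := expR_gt0 x.
have : (1 - x) * expR x <= 1 by rewrite -ler_pdivlMr// div1r.
have : 0 <= x ^+ 2 * (1 - 2 * x) by rewrite mulr_ge0 ?sqr_ge0//; lra.
nra.
Qed.

(** The pairwise products of three independent signs add up to 3 with probability [1/4] and to [- 1]
    with probability [3/4]; each coordinate contributes the mean of the exponential of [b] times
    this sum. *)
Definition third_moment b d := ((expR (3 * b) + 3 * expR (- b)) / 4) ^+ d.

(** The terms of first order in [b] cancel, which leaves [1 + 6 b^2] per coordinate and at most
    [1 + 12 d b^2] in all. *)
Lemma third_moment_le b m d : (0 < m)%N -> (0 < d)%N -> 0 <= b ->
  m%:R * d%:R * b ^+ 2 <= 100^-1 ^+ 2 ->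
  m%:R * (third_moment b d - 1) <= 500^-1.
Proof.
move=> m0 d0 b0 mdb.
have m1 : 1 <= m%:R :> R by rewrite ler1n.
have d1 : 1 <= d%:R :> R by rewrite ler1n.
have b2 : 0 <= b ^+ 2 by exact: sqr_ge0.
have db2 : 0 <= d%:R * b ^+ 2 by rewrite mulr_ge0.
have dbm : d%:R * b ^+ 2 <= m%:R * d%:R * b ^+ 2.
  by rewrite -mulrA ler_peMl.
have bdb : b ^+ 2 <= d%:R * b ^+ 2 by rewrite ler_peMl.
have b1 : b <= 100^-1 by rewrite -(ler_sqr b0) ?nnegrE ?invr_ge0//; lra.
have h1 : expR (3 * b) <= 1 + 3 * b + 2 * (3 * b) ^+ 2.
  by apply: expR_le_quadratic; lra.
have h2 : expR (- b) <= 1 + - b + 2 * (- b) ^+ 2.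
  by apply: expR_le_quadratic; lra.
have base : (expR (3 * b) + 3 * expR (- b)) / 4 <= expR (6 * b ^+ 2).
  by apply: le_trans (expR_ge1Dx _); nra.
have T1 : third_moment b d <= expR (6 * (d%:R * b ^+ 2)).
  have -> : expR (6 * (d%:R * b ^+ 2)) = expR (6 * b ^+ 2) ^+ d.
    by rewrite -expRM_natl mulrCA.
  by rewrite /third_moment lerXn2r ?nnegrE ?expR_ge0.
have T2 : expR (6 * (d%:R * b ^+ 2)) <= 1 + 12 * (d%:R * b ^+ 2).
  have h3 : 6 * (d%:R * b ^+ 2) <= 1 / 2 by lra.
  by apply: (le_trans (expR_le_quadratic h3)); nra.
have : m%:R * (third_moment b d - 1) <= m%:R * (12 * (d%:R * b ^+ 2)).
  by rewrite ler_wpM2l//; lra.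
lra.
Qed.

Lemma cosh_moment_le b m d : (0 < m)%N -> (0 < d)%N -> 0 <= b ->
  m%:R * d%:R * b ^+ 2 <= 100^-1 ^+ 2 ->
  ((expR b + expR (- b)) / 2) ^+ (d * m.+1) <= (1001 / 1000) ^+ 2.
Proof.
move=> m0 d0 b0 mdb.
have m1 : 1 <= m%:R :> R by rewrite ler1n.
have d1 : 1 <= d%:R :> R by rewrite ler1n.
have b2 : 0 <= b ^+ 2 by exact: sqr_ge0.
have db2 : 0 <= d%:R * b ^+ 2 by rewrite mulr_ge0.
have dbm : d%:R * b ^+ 2 <= m%:R * d%:R * b ^+ 2.
  by rewrite -mulrA ler_peMl.
have bdb : b ^+ 2 <= d%:R * b ^+ 2 by rewrite ler_peMl.
have b1 : b <= 100^-1 by rewrite -(ler_sqr b0) ?nnegrE ?invr_ge0//; lra.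
have h1 : expR b <= 1 + b + 2 * b ^+ 2 by apply: expR_le_quadratic; lra.
have h2 : expR (- b) <= 1 + - b + 2 * (- b) ^+ 2.
  by apply: expR_le_quadratic; lra.
have base : (expR b + expR (- b)) / 2 <= expR (2 * b ^+ 2).
  by apply: le_trans (expR_ge1Dx _); nra.
apply: (@le_trans _ _ (expR (2 * b ^+ 2) ^+ (d * m.+1))).
  by rewrite lerXn2r ?nnegrE ?expR_ge0.
rewrite -expRM_natl natrM -natr1.
have : d%:R * (m%:R + 1) * (2 * b ^+ 2) <= 4 * (m%:R * d%:R * b ^+ 2) by nra.
rewrite -ler_expR => /le_trans; apply.
set y := m%:R * d%:R * b ^+ 2 in mdb *.
have y0 : 0 <= y by rewrite /y -mulrA mulr_ge0.
have h3 : 4 * y <= 1 / 2 by lra.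
by apply: (le_trans (expR_le_quadratic h3)); nra.
Qed.

(** This is the condition [kp_km] at the exponent [1 + 1/m]. The quotient of the two sides is
    governed by [tanh b], of order [b], so [b] must be of order [1/m]. *)
Lemma sinh_le_cosh b m : (0 < m)%N -> 0 <= b -> m%:R * b <= 50^-1 ->
  expR b - expR (- b) <= m%:R^-1 / 8 * (expR b + expR (- b)).
Proof.
move=> m0 b0 mb.
have m1 : 0 < m%:R :> R by rewrite ltr0n.
have e0 := expR_gt0 b; have e0' := expR_gt0 (- b).
have h : expR b - expR (- b) <= 2 * b * expR b.
  have -> : expR (- b) = expR b * expR (- (2 * b)) by rewrite -expRD; congr expR; ring.
  by have := expR_ge1Dx (- (2 * b)); nra.
apply: (le_trans h); have : 2 * b <= m%:R^-1 / 8.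
  have i0 : 0 <= m%:R^-1 :> R by rewrite invr_ge0.
  have := ler_wpM2l i0 mb; rewrite mulKf ?gt_eqF//; lra.
by move=> h2; apply: ler_pM => //; lra.
Qed.

Lemma sqrt_min_le m x : sqrt_min m x <= Num.sqrt m%:R.
Proof. by rewrite /sqrt_min; case: ifP => // _; rewrite ge_min lexx. Qed.

(** The conclusion is the square of [sqrt (m d) b <= 1/100]. Bounding the minimum by [sqrt m]
    handles the local and the shared rate at once, hence the free [x]. *)
Lemma sqrt_rate_le n m d rho x : (0 < n)%N -> (0 < m)%N -> (0 < d)%N ->
  rho ^+ 2 <= 100^-1 * (sqrt_min m x * Num.sqrt d%:R / (m%:R * n%:R)) ->
  m%:R * d%:R * (n%:R * rho ^+ 2 / d%:R) ^+ 2 <= 100^-1 ^+ 2 :> R.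
Proof.
move=> n0 m0 d0 h.
have nR : 0 < n%:R :> R by rewrite ltr0n.
have mR : 0 < m%:R :> R by rewrite ltr0n.
have dR : 0 < d%:R :> R by rewrite ltr0n.
have sm := sqr_sqrtr (ltW mR); have sd := sqr_sqrtr (ltW dR).
have := sqrt_min_le m x; move: h sm sd.
have := sqrtr_ge0 (m%:R : R); have := sqrtr_ge0 (d%:R : R).
set u := Num.sqrt m%:R; set v := Num.sqrt d%:R; set w := sqrt_min m x.
move=> v0 u0 h uu vv wu.
have u_gt0 : 0 < u by rewrite sqrtr_gt0.
have v_gt0 : 0 < v by rewrite sqrtr_gt0.
have h2 : rho ^+ 2 <= 100^-1 * (u * v / (m%:R * n%:R)).
  apply: (le_trans h); rewrite ler_wpM2l ?invr_ge0//.
  by rewrite ler_wpM2r ?invr_ge0 ?mulr_ge0 ?ler_wpM2r// ltW.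
have h3 : u * v * (n%:R * rho ^+ 2 / d%:R) <= 100^-1.
  rewrite -uu -vv in h2 *.
  have -> : 100^-1 = u * v * (n%:R * (100^-1 * (u * v / (u ^+ 2 * n%:R))) / v ^+ 2).
    by field; rewrite !gt_eqF.
  rewrite ler_wpM2l ?mulr_ge0// ler_wpM2r ?invr_ge0 ?sqr_ge0//.
  by rewrite ler_wpM2l// ltW.
have X0 : 0 <= n%:R * rho ^+ 2 / d%:R.
  by apply: divr_ge0; [apply: mulr_ge0; [exact: ltW|exact: sqr_ge0]|exact: ltW].
move: X0 h3; set X := _ / d%:R => X0 h3.
have L0 : 0 <= u * v * X by apply: mulr_ge0 => //; exact: mulr_ge0.
by rewrite -uu -vv -!exprMn lerXn2r ?nnegrE ?invr_ge0.
Qed.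

(** Here the other member of the minimum is used: for [m >= 2] it is at most [2 sqrt d] because
    [ln m >= 1/4]. For [m = 1] the minimum is read as [1 <= sqrt d]. *)
Lemma shared_rate_linear n m d rho : (0 < n)%N -> (0 < m)%N -> (0 < d)%N ->
  rho ^+ 2 <= 100^-1 * shared_rate n m d ->
  m%:R * (n%:R * rho ^+ 2 / d%:R) <= 50^-1 :> R.
Proof.
move=> n0 m0 d0; rewrite /shared_rate => h.
have nR : 0 < n%:R :> R by rewrite ltr0n.
have mR : 0 < m%:R :> R by rewrite ltr0n.
have dR : 0 < d%:R :> R by rewrite ltr0n.
have v_gt0 : 0 < Num.sqrt d%:R :> R by rewrite sqrtr_gt0.
have w2 : sqrt_min m (Num.sqrt (d%:R / ln m%:R)) <= 2 * Num.sqrt d%:R :> R.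
  rewrite /sqrt_min; have [->|m1] := eqVneq m 1%N.
    rewrite sqrtr1; have : 1 <= Num.sqrt d%:R :> R.
      by rewrite -[leLHS]sqrtr1 ler_sqrt// ler1n.
    lra.
  have lnm : 4^-1 <= ln (m%:R : R).
    have : ln (2 : R) <= ln m%:R.
      by rewrite ler_ln ?posrE// ler_nat ltn_neqAle eq_sym m1.
    have := xlnx_ge (ler0n R 2); lra.
  rewrite ge_min; apply/orP; right.
  have -> : 2 * Num.sqrt d%:R = Num.sqrt (4 * d%:R) :> R.
    rewrite sqrtrM// (_ : 4 = 2 ^+ 2); last by ring.
    by rewrite sqrtr_sqr ger0_norm.
  rewrite ler_sqrt ?mulr_ge0//.
  by rewrite mulrC ler_wpM2r// invf_ple ?posrE//; lra.
have sd := sqr_sqrtr (ltW dR).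
move: h w2 sd; set v := Num.sqrt d%:R in v_gt0 *; set w := sqrt_min _ _.
move=> h wv vv.
have h2 : rho ^+ 2 <= 100^-1 * (2 * v * v / (m%:R * n%:R)).
  apply: (le_trans h); rewrite ler_wpM2l ?invr_ge0//.
  by rewrite ler_wpM2r ?invr_ge0 ?mulr_ge0 ?ler_wpM2r// ltW.
have -> : 50^-1 = m%:R * (n%:R * (100^-1 * (2 * v * v / (m%:R * n%:R))) / d%:R) :> R.
  by rewrite -vv; field; rewrite !gt_eqF.
apply: ler_wpM2l; first exact: ltW.
apply: ler_wpM2r; first by rewrite invr_ge0 ltW.
by apply: ler_wpM2l => //; exact: ltW.
Qed.

End rates.

(** * Measures with a density, pi-systems and independence *)

Section density_measure.
Local Open Scope ereal_scope.
Context d (T : measurableType d) (R : realType).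
Variables (mu : {measure set T -> \bar R}) (Y : T -> R).
Hypotheses (mY : measurable_fun setT Y) (Y0 : forall x, (0 <= Y x)%R).

(** The two proofs are arguments so that the measure structure declared below can be attached to
    [density_measure mY Y0]. *)
Definition density_measure of measurable_fun setT Y & (forall x, (0 <= Y x)%R) :
  set T -> \bar R := fun A => \int[mu]_(x in A) (Y x)%:E.

Let nu := density_measure mY Y0.

Let nu0 : nu set0 = 0. Proof. exact: integral_set0. Qed.

Let nu_ge0 A : 0 <= nu A.
Proof. by apply: integral_ge0 => x _; rewrite lee_fin. Qed.

Let nu_sigma_additive : semi_sigma_additive nu.
Proof.
apply: semi_sigma_additive_nng_induced; first exact/measurable_EFinP.
by move=> x; rewrite lee_fin.
Qed.

HB.instance Definition _ := isMeasure.Build _ _ _ (density_measure mY Y0)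
  nu0 nu_ge0 nu_sigma_additive.

Import HBNNSimple.

(** Monotone approximation by simple functions reduces the identity to indicators, where it is the
    definition of the measure. *)
Lemma ge0_integral_density (f : T -> \bar R) :
  measurable_fun setT f -> (forall x, 0 <= f x) ->
  \int[density_measure mY Y0]_x f x = \int[mu]_x (f x * (Y x)%:E).
Proof.
move=> mf f0; pose f_ := nnsfun_approx measurableT mf.
have f_cvg x : EFin \o f_^~ x @ \oo --> f x by exact: cvg_nnsfun_approx.
have mYE : measurable_fun setT (EFin \o Y) by exact/measurable_EFinP.
transitivity (limn (fun n => \int[density_measure mY Y0]_x (f_ n x)%:E)).
  rewrite -monotone_convergence//.
  - by apply: eq_integral => y _; apply/esym/cvg_lim => //; exact: f_cvg.
  - by move=> n; exact/measurable_EFinP/measurable_funP.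
  - by move=> n y _; rewrite lee_fin.
  - by move=> y _ m n mn; rewrite lee_fin; exact/lefP/nd_nnsfun_approx.
rewrite [X in limn X](_ : _ = fun n => \int[mu]_x ((f_ n x)%:E * (Y x)%:E)).
  rewrite -monotone_convergence//; last 3 first.
  - move=> n; apply: emeasurable_funM => //.
    by exact/measurable_EFinP/measurable_funP.
  - by move=> n x _; rewrite mule_ge0// lee_fin.
  - move=> x _ m n mn; rewrite lee_wpmul2r// lee_fin//.
    exact/lefP/nd_nnsfun_approx.
  apply: eq_integral => x _; apply/cvg_lim => //.
  by apply: cvgeZr => //; exact: f_cvg.
apply/funext => n.
transitivity (\int[density_measure mY Y0]_x
   (\sum_(y \in range (f_ n)) (y * \1_(f_ n @^-1` [set y]) x)%:E)).
  by apply: eq_integral => t _; rewrite /= fimfunE -fsumEFin.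
have indich r : measurable_fun setT (fun x => (r * \1_(f_ n @^-1` [set r]) x)%:E).
  by apply: (measurable_comp measurableT) => //; exact: measurable_funM.
rewrite ge0_integral_fsum//; last by move=> m y _; exact: nnfun_muleindic_ge0.
transitivity (\int[mu]_x (\sum_(y \in range (f_ n))
    (y * \1_(f_ n @^-1` [set y]) x)%:E * (Y x)%:E)); last first.
  under [RHS]eq_integral => x _.
    rewrite (fimfunE _ x) -fsumEFin// ge0_mule_fsuml; last first.
      by move=> y; exact: nnfun_muleindic_ge0.
    over.
  by [].
rewrite ge0_integral_fsum//; last 2 first.
- by move=> y; exact: emeasurable_funM.
- by move=> m y _; apply: mule_ge0; [exact: nnfun_muleindic_ge0|rewrite lee_fin].
apply: eq_fsbigr => r rhn.
under [LHS]eq_integral do rewrite EFinM.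
rewrite integralZl_indic_nnsfun => //.
under [RHS]eq_integral do rewrite EFinM -muleA.
rewrite ge0_integralZl//.
- under [in RHS]eq_integral do rewrite muleC.
  rewrite [in RHS](eq_integral ((EFin \o Y) \_ (f_ n @^-1` [set r]))); last first.
    by move=> x _; rewrite epatch_indic.
  by rewrite -integral_mkcond integral_indic// setIT.
- by apply: emeasurable_funM => //; exact/measurable_EFinP.
- by move=> t _; rewrite mule_ge0 ?lee_fin.
- by move: rhn; rewrite inE => -[t _ <-]; rewrite lee_fin.
Qed.

End density_measure.

Section pi_system.
Local Open Scope ereal_scope.
Context d d' (T : measurableType d) (S : measurableType d') (R : realType).

(** The two measures may differ on [T]; only their images under [W] are compared. These agree on a
    pi-system and are finite, hence coincide. *)
Lemma pi_system_integral_eq (G : set (set S)) (W : T -> S)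
    (m1 m2 : {measure set T -> \bar R}) :
  measurable_fun setT W ->
  measurable = <<s G >> -> setI_closed G -> G setT -> m1 setT < +oo ->
  (forall A, G A -> m1 (W @^-1` A) = m2 (W @^-1` A)) ->
  forall h : S -> \bar R, measurable_fun setT h -> (forall x, 0 <= h x) ->
  \int[m1]_x h (W x) = \int[m2]_x h (W x).
Proof.
move=> mW mG GI GT m1T m12 h mh h0.
rewrite -[LHS](@ge0_integral_pushforward _ _ _ _ _ W mW m1 setT h)//.
rewrite -[RHS](@ge0_integral_pushforward _ _ _ _ _ W mW m2 setT h)//.
apply: eq_measure_integral => A mA _.
apply: (measure_unique G (fun=> setT)) => //.
- by rewrite bigcup_const.
Qed.

End pi_system.

Section independence.
Local Open Scope ereal_scope.
Context d (T : measurableType d) (R : realType) (P : probability T R).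
Context (I : finType) (dS : I -> measure_display)
  (S : forall i, measurableType (dS i)) (W : forall i, T -> S i)
  (mW : forall i, measurable_fun setT (@W i)) (G : forall i, set (set (S i))).
Hypotheses (mG : forall i, measurable = <<s @G i >>)
  (GI : forall i, setI_closed (@G i)) (GT : forall i, @G i setT).
Hypothesis GW : forall A : forall i, set (S i), (forall i, @G i (A i)) ->
  P [set w | forall i, A i (@W i w)] = \prod_i P (@W i @^-1` A i).

(** Hybrid families: general integrable functions of [W i] at the indices in [s], indicators of
    generating events elsewhere. The product rule is carried from [s] empty to [s] full, one index
    at a time. *)
Let admissible (s : seq I) (F : I -> T -> R) := forall i,
  if i \in s then exists h : S i -> R,
      [/\ measurable_fun setT h, forall x, (0 <= h x)%R,
          F i = h \o @W i & \int[P]_w (F i w)%:E < +oo]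
  else exists2 A, @G i A & F i = \1_(@W i @^-1` A).

Let mGi i A : @G i A -> measurable A.
Proof. by rewrite mG; exact: sub_sigma_algebra. Qed.

Let mWG i A : @G i A -> measurable (@W i @^-1` A).
Proof.
move=> GA; rewrite -[X in measurable X]setTI.
by apply: mW => //; exact: mGi.
Qed.

Let admissible_fun s F : admissible s F -> forall i,
  [/\ measurable_fun setT (F i), forall w, (0 <= F i w)%R
     & \int[P]_w (F i w)%:E < +oo].
Proof.
move=> + i => /(_ i); case: ifPn => _.
  move=> [h [mh h0 Fh Foo]]; split => //; last by move=> w; rewrite Fh/=.
  by rewrite Fh; exact: measurableT_comp.
move=> [A GA ->].
have mWA : measurable (@W i @^-1` A).
  exact: mWG.
split => //.
rewrite integral_indic// setIT; apply: le_lt_trans (probability_le1 _ _) _ => //.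
by rewrite ltry.
Qed.

(** To upgrade the index [k], the product [Y] of the other factors serves as a density. By the
    induction hypothesis with an indicator at [k], the measure [Y P] agrees with the constant
    [kappa] times [P] on generating events of [W k], hence in integrals of functions of [W k]. *)
Let independent_admissible s F : admissible s F ->
  \int[P]_w (\prod_i F i w)%:E = \prod_i \int[P]_w (F i w)%:E.
Proof.
elim: s F => [|k s IH] F adF.
  have {}adF i : {A | @G i A & F i = \1_(@W i @^-1` A)}.
    by apply: cid2; have := adF i.
  pose A i := s2val (adF i).
  have GA i : @G i (A i) by exact: (s2valP (adF i)).
  have FA i : F i = \1_(@W i @^-1` A i) by exact: (s2valP' (adF i)).
  have mWA i : measurable (@W i @^-1` A i).
    exact: mWG.
  have mB : measurable [set w | forall i, A i (@W i w)].
    rewrite (_ : [set w | _] = \bigcap_(i in [set` enum I]) (@W i @^-1` A i)).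
      by apply: fin_bigcap_measurable => //; exact: finite_seq.
    apply/seteqP; split => [w h i _|w h i]; first exact: h.
    by apply: h; rewrite /= mem_enum.
  transitivity (P [set w | forall i, A i (@W i w)]).
    rewrite -[X in P X]setIT -integral_indic//; apply: eq_integral => w _.
    congr EFin; rewrite indicE; have [wA|wA] := boolP (w \in _).
      rewrite big1// => i _; rewrite FA indicE mem_set//=.
      by move: wA; rewrite inE; exact.
    move: wA; rewrite notin_setE/= => /existsNP[i Ai].
    by rewrite (bigD1 i)//= FA indicE memNset// mul0r.
  rewrite GW//; apply: eq_bigr => i _; rewrite FA integral_indic//.
  by rewrite setIT.
have [ks|ks] := boolP (k \in s).
  apply: IH => i; have := adF i; rewrite inE.
  by have [->|//] := eqVneq i k; rewrite ks.
have := adF k; rewrite inE eqxx/= => -[h [mh h0 Fk Fkoo]].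
pose Y w := (\prod_(i | i != k) F i w)%R.
have F_ge0 i w : (0 <= F i w)%R by have [] := admissible_fun adF i.
have mF i : measurable_fun setT (F i) by have [] := admissible_fun adF i.
have Y0 w : (0 <= Y w)%R by rewrite /Y prodr_ge0.
have mY : measurable_fun setT Y.
  rewrite /Y; under eq_fun do rewrite -big_filter.
  exact: measurable_prod.
have Ik : \prod_(i | i != k) \int[P]_w (F i w)%:E \is a fin_num.
  apply: prode_fin_num => i _; rewrite ge0_fin_numE; last first.
    by apply: integral_ge0 => w _; rewrite lee_fin.
  by have [] := admissible_fun adF i.
have Ik0 : (0 <= fine (\prod_(i | i != k) \int[P]_w (F i w)%:E))%R.
  rewrite fine_ge0// prode_ge0// => i _.
  by apply: integral_ge0 => w _; rewrite lee_fin.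
pose kappa := NngNum Ik0.
have step A : @G k A ->
    \int[P]_(w in @W k @^-1` A) (Y w)%:E =
    kappa%:num%:E * P (@W k @^-1` A).
  move=> GA.
  pose F' i := if i == k then \1_(@W k @^-1` A) else F i.
  have adF' : admissible s F'.
    move=> i; rewrite /F'; have [->|ik] := eqVneq i k.
      by rewrite (negbTE ks); exists A.
    by have := adF i; rewrite inE (negbTE ik).
  have mWA : measurable (@W k @^-1` A).
    exact: mWG.
  have F'k : F' k = \1_(@W k @^-1` A) by rewrite /F' eqxx.
  have F'i i : i != k -> F' i = F i by rewrite /F' => /negbTE ->.
  have := IH _ adF'.
  rewrite [RHS](bigD1 k)//= F'k integral_indic// setIT.
  rewrite [in X in _ = X -> _](eq_bigr (fun i => \int[P]_w (F i w)%:E)); last first.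
    by move=> i ik; rewrite F'i.
  rewrite /kappa/= fineK// [RHS]muleC => <-.
  rewrite integral_mkcond; apply: eq_integral => w _.
  rewrite (bigD1 k)//= F'k epatch_indic/= -EFinM mulrC.
  congr (_ * _)%:E; apply: eq_bigr => i ik.
  by rewrite F'i.
have densT : density_measure P mY Y0 setT < +oo.
  have := step setT (@GT k); rewrite preimage_setT => h1.
  by rewrite /density_measure h1 probability_setT mule1 ltry.
have mhW : measurable_fun setT (fun w => (h (@W k w))%:E).
  by apply/measurable_EFinP; exact: measurableT_comp.
have E : \int[density_measure P mY Y0]_w (h (@W k w))%:E =
    \int[mscale kappa P]_w (h (@W k w))%:E.
  apply: (pi_system_integral_eq (m1 := density_measure P mY Y0)
    (m2 := mscale kappa P) (@mW k) (mG k) (@GI k) (@GT k) densT step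
    (h := EFin \o h)) => //.
  exact/measurable_EFinP.
have hW0 w : 0 <= (h (@W k w))%:E by rewrite lee_fin.
transitivity (\int[P]_w ((h (@W k w))%:E * (Y w)%:E)).
  by apply: eq_integral => w _; rewrite (bigD1 k)//= Fk EFinM.
rewrite -ge0_integral_density// E ge0_integral_mscale//.
rewrite [RHS](bigD1 k)//= /kappa/= fineK// muleC; congr (_ * _).
by apply: eq_integral => w _; rewrite Fk.
Qed.

Lemma independent_expectation_prod (h : forall i, S i -> R) :
  (forall i, measurable_fun setT (@h i)) -> (forall i x, (0 <= @h i x)%R) ->
  (forall i, \int[P]_w (@h i (@W i w))%:E < +oo) ->
  \int[P]_w (\prod_i @h i (@W i w))%:E = \prod_i \int[P]_w (@h i (@W i w))%:E.
Proof.
move=> mh h0 hoo.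
apply: (@independent_admissible (enum I) (fun i => @h i \o @W i)) => i.
by rewrite mem_enum/=; exists (@h i).
Qed.

End independence.

Lemma measurable_sigma_algebraE d (T : measurableType d) :
  @measurable _ T = <<s measurable >>.
Proof.
by apply/seteqP; split; [exact: sub_sigma_algebra|apply: smallest_sub => //;
  exact: sigma_algebra_measurable].
Qed.

Section boxes.
Context d (T : measurableType d) (n : nat).

Definition box : set (set (n.-tuple T)) :=
  [set C | exists2 A : 'I_n -> set T, (forall i, measurable (A i)) &
    C = [set t | forall i, A i (tnth t i)]].

Lemma setI_closed_box : setI_closed box.
Proof.
move=> _ _ [A mA ->] [B mB ->]; exists (fun i => A i `&` B i).
  by move=> i; exact: measurableI.
apply/seteqP; split=> [t [tA tB] i|t h]; first by split.
by split=> i; have [] := h i.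
Qed.

Lemma box_setT : box setT.
Proof. by exists (fun=> setT) => //; apply/seteqP; split. Qed.

Lemma measurable_box C : box C -> measurable C.
Proof.
move=> [A mA ->].
rewrite (_ : [set t | _] =
    \bigcap_(i in [set` enum 'I_n]) ((@tnth _ T ^~ i) @^-1` A i)).
  apply: fin_bigcap_measurable => [|i _]; first exact: finite_seq.
  by rewrite -[X in measurable X]setTI; exact: measurable_tnth.
apply/seteqP; split=> [t h i _|t h i]; first exact: h.
by apply: h; rewrite /= mem_enum.
Qed.

Lemma measurable_tupleE : @measurable _ (n.-tuple T) = <<s box >>.
Proof.
apply/seteqP; split; last first.
  apply: smallest_sub; first exact: sigma_algebra_measurable.
  exact: measurable_box.
apply: smallest_sub; first exact: smallest_sigma_algebra.
rewrite -bigcup_seq; apply: bigcup_sub => i _ _ [A mA <-].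
apply: sub_sigma_algebra.
exists (fun j => if j == i then A else setT) => [j|]; first by case: ifP.
rewrite setTI; apply/seteqP; split=> [t tA j|t /(_ i)]; last by rewrite eqxx.
by case: eqP => // ->.
Qed.

End boxes.

Section independent_pair.
Local Open Scope ereal_scope.
Context d d1 d2 (T : measurableType d) (S1 : measurableType d1)
  (S2 : measurableType d2) (R : realType) (P : probability T R).
Variables (X : T -> S1) (Y : T -> S2) (G : set (set S1)).
Hypotheses (mX : measurable_fun setT X) (mY : measurable_fun setT Y).
Hypotheses (mG : measurable = <<s G >>) (GI : setI_closed G) (GT : G setT).
Hypothesis XY : forall A B, G A -> measurable B ->
  P (X @^-1` A `&` Y @^-1` B) = P (X @^-1` A) * P (Y @^-1` B).

Let mYB A : measurable A -> measurable (Y @^-1` A).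
Proof. by move=> mA; rewrite -[X in measurable X]setTI; exact: mY. Qed.

(** For fixed [B] both sides are finite measures in [A], so agreement on the pi-system [G] extends
    to all measurable sets. *)
Let independent_events A B : measurable A -> measurable B ->
  P (X @^-1` A `&` Y @^-1` B) = P (X @^-1` A) * P (Y @^-1` B).
Proof.
move=> mA mB.
have PB0 : (0 <= fine (P (Y @^-1` B)))%R by rewrite fine_ge0.
have PB : P (Y @^-1` B) \is a fin_num by exact: fin_num_measure (mYB mB).
have E C : (mscale (NngNum PB0) P) C = P C * P (Y @^-1` B).
  by rewrite /mscale/= fineK// muleC.
rewrite -E -[LHS]/(mrestr P (mYB mB) (X @^-1` A)).
rewrite -[LHS]/(pushforward (mrestr P (mYB mB)) X A).
rewrite -[RHS]/(pushforward (mscale (NngNum PB0) P) X A).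
apply: (measure_unique G (fun=> setT)) => //.
- by rewrite bigcup_const.
- by move=> C GC; rewrite /= /pushforward/= E /mrestr XY.
- move=> _; rewrite /= /pushforward preimage_setT /mrestr setTI.
  by rewrite ltey_eq PB.
Qed.

Lemma measurable_independent_pair_integral (h : S1 * S2 -> \bar R) :
  measurable_fun setT h -> (forall x, 0 <= h x) ->
  measurable_fun setT (fun w => \int[P]_w' h (X w', Y w)).
Proof.
move=> mh h0.
pose X' : {RV P >-> S1} := HB.pack X (isMeasurableFun.Build _ _ _ _ _ mX).
rewrite (_ : (fun w => _) = fubini_G (distribution P X') h \o Y).
  by apply: measurableT_comp => //; exact: measurable_fun_fubini_tonelli_G.
apply/funext => w; rewrite /= /fubini_G ge0_integral_pushforward//.
exact: measurableT_comp.
Qed.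

(** The joint law is the product of the laws and Tonelli's theorem applies. This is the device for
    freezing the auxiliary variable. *)
Lemma independent_pair_integral (h : S1 * S2 -> \bar R) :
  measurable_fun setT h -> (forall x, 0 <= h x) ->
  \int[P]_w h (X w, Y w) = \int[P]_w \int[P]_w' h (X w', Y w).
Proof.
move=> mh h0.
have mXY : measurable_fun setT (fun w => (X w, Y w)).
  exact: measurable_fun_pair.
rewrite -[LHS](@ge0_integral_pushforward _ _ _ _ _ _ mXY P setT h)//.
pose X' : {RV P >-> S1} := HB.pack X (isMeasurableFun.Build _ _ _ _ _ mX).
pose Y' : {RV P >-> S2} := HB.pack Y (isMeasurableFun.Build _ _ _ _ _ mY).
transitivity (\int[distribution P X' \x distribution P Y']_z h z).
  apply: eq_measure_integral => A mA _.
  by apply/esym/product_measure_unique => // B C mB mC; exact: independent_events.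
rewrite fubini_tonelli2// ge0_integral_pushforward//.
- apply: eq_integral => w _; rewrite /fubini_G/= ge0_integral_pushforward//.
  exact: measurableT_comp.
- exact: measurable_fun_fubini_tonelli_G.
- by move=> y _; exact: integral_ge0.
Qed.

End independent_pair.

(** * Gaussian shifts and their likelihood ratios *)

Section normal_shift.
Local Open Scope ereal_scope.
Context {R : realType}.
Local Notation mu := (@lebesgue_measure R).
Local Notation N01 := (@normal_prob R 0%R 1%R).

Lemma lebesgue_measure_translation (v : R) (A : set R) : measurable A ->
  pushforward mu (fun x : measurableTypeR R => (x + v)%R : measurableTypeR R) A =
  mu A.
Proof.
move=> mA; apply/esym/lebesgue_measure_unique => //=.
  exact: measurable_funD.
move=> mf _ [[a b]] _ <-.
rewrite /pushforward/= (_ : _ @^-1` _ = `](a - v)%R, (b - v)%R]%classic).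
  by rewrite !lebesgue_measure_itv/= !lte_fin ltrD2r; case: ifP => // _;
    rewrite -!EFinB; congr EFin; ring.
by apply/seteqP; split => x /=; rewrite !in_itv/=; lra.
Qed.

Lemma ge0_integral_normal (f : R -> \bar R) : measurable_fun setT f ->
  (forall x, 0 <= f x) ->
  \int[N01]_x f x = \int[mu]_x (f x * (normal_pdf 0 1 x)%:E).
Proof.
move=> mf f0.
have mpdf := measurable_normal_pdf (0 : R) 1.
have pdf0 := normal_pdf_ge0 (0 : R) 1.
by rewrite -(ge0_integral_density mu mpdf pdf0)//.
Qed.

Lemma normal_pdf_shift (v x : R) :
  normal_pdf 0 1 (x - v) = (expR (v * x - v ^+ 2 / 2) * normal_pdf 0 1 x)%R.
Proof.
rewrite !normal_pdfE ?oner_eq0// mulrCA; congr (_ * _)%R.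
by rewrite /normal_fun -expRD; congr expR; rewrite !subr0 expr1n; field.
Qed.

(** Translation invariance of Lebesgue measure moves the shift to the density, and
    [normal_pdf_shift] expresses the shifted density through the original one. *)
Lemma normal_shift (v : R) (h : R -> \bar R) : measurable_fun setT h ->
  (forall x, 0 <= h x) ->
  \int[N01]_x h (x + v)%R = \int[N01]_x (h x * (expR (v * x - v ^+ 2 / 2))%:E).
Proof.
move=> mh h0.
have madd : measurable_fun setT (fun x : measurableTypeR R => (x + v)%R : measurableTypeR R).
  exact: measurable_funD.
have mexp : measurable_fun setT (fun x : R => expR (v * x - v ^+ 2 / 2)).
  apply: measurableT_comp => //; exact: measurable_funB.
have mpdf := measurable_normal_pdf (0 : R) 1.
have pdf0 := normal_pdf_ge0 (0 : R) 1.
have msub : measurable_fun setT (fun x : R => (x - v)%R) by exact: measurable_funB.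
have mhv : measurable_fun setT (fun x : R => h (x + v)%R).
  by apply: measurableT_comp => //; exact: measurable_funD.
have mhe : measurable_fun setT (fun x : R => h x * (expR (v * x - v ^+ 2 / 2))%:E).
  by apply: emeasurable_funM => //; exact/measurable_EFinP.
have he0 x : 0 <= h x * (expR (v * x - v ^+ 2 / 2))%:E.
  by rewrite mule_ge0// lee_fin expR_ge0.
rewrite (ge0_integral_normal mhv)// (ge0_integral_normal mhe he0).
pose F (x : R) := h x * (normal_pdf 0 1 (x - v))%:E.
have mF : measurable_fun setT F.
  apply: emeasurable_funM => //; apply/measurable_EFinP.
  exact: (measurableT_comp mpdf msub).
have F0 : {in [set: R], forall x, 0 <= F x}.
  by move=> x _; rewrite mule_ge0// lee_fin.
transitivity (\int[mu]_x F x); last first.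
  by apply: eq_integral => x _; rewrite /F normal_pdf_shift EFinM muleA.
transitivity (\int[mu]_x F (x + v)%R).
  by apply: eq_integral => x _; rewrite /F addrK.
rewrite -[LHS](@ge0_integral_pushforward _ _ _ _ _ _ madd mu setT F measurableT mF F0).
apply: eq_measure_integral => A mA _; exact: lebesgue_measure_translation.
Qed.

(** [normal_shift] with [h = 1] says that the likelihood ratio has mean 1. *)
Lemma normal_mgf (t : R) : \int[N01]_x (expR (t * x))%:E = (expR (t ^+ 2 / 2))%:E.
Proof.
have := @normal_shift t (cst 1) (measurable_cst _) (fun=> @lee01 R).
rewrite integral_cst// [X in 1 * X](_ : _ = 1) ?mule1 => [E|]; last first.
  exact: (@probability_setT _ _ _ (normal_prob 0%R 1%R)).
transitivity (\int[N01]_x ((expR (t ^+ 2 / 2))%:E * (cst 1 x * (expR (t * x - t ^+ 2 / 2))%:E))).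
  apply: eq_integral => x _; rewrite mul1e -EFinM -expRD; congr (expR _)%:E; ring.
rewrite ge0_integralZl//; last 2 first.
- apply: emeasurable_funM => //; apply/measurable_EFinP.
  apply: measurableT_comp => //; exact: measurable_funB.
- by move=> x _; rewrite mul1e lee_fin expR_ge0.
by rewrite -E mule1.
Qed.

End normal_shift.

Section gaussian.
Local Open Scope ereal_scope.
Context dO (Omega : measurableType dO) (R : realType) (P : probability Omega R).
Context (d : nat) (Z : {RV P >-> d.-tuple R}).
Hypothesis gZ : standard_gaussian Z.
Local Notation N01 := (@normal_prob R 0%R 1%R).

Let mZ : measurable_fun setT Z. Proof. exact: measurable_funP. Qed.

Let mcoord i : measurable_fun setT (fun w => tnth (Z w) i).
Proof. exact: measurableT_comp (@measurable_tnth _ R d i) mZ. Qed.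

Lemma gaussian_coord i (A : set R) : measurable A ->
  P ((fun w => tnth (Z w) i) @^-1` A) = N01 A.
Proof.
move=> mA; pose A' j := if j == i then A else setT.
have mA' j : measurable (A' j) by rewrite /A'; case: ifP.
have := gZ mA'; rewrite [RHS](bigD1 i)//= big1 => [|j ji]; last first.
  by rewrite /A' (negbTE ji); exact: (@probability_setT _ _ _ (normal_prob 0%R 1%R)).
rewrite mule1 {2}/A' eqxx => <-; congr (P _).
apply/seteqP; split=> w /= => [h j|/(_ i)]; last by rewrite /A' eqxx.
by rewrite /A'; case: eqP => // ->.
Qed.

Lemma gaussian_coord_integral i (h : R -> \bar R) :
  measurable_fun setT h -> (forall x, 0 <= h x) ->
  \int[P]_w h (tnth (Z w) i) = \int[N01]_x h x.
Proof.
move=> mh h0; pose c (w : Omega) : measurableTypeR R := tnth (Z w) i.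
have mc : measurable_fun setT c by exact: mcoord.
transitivity (\int[pushforward P c]_x h x).
  by rewrite (ge0_integral_pushforward mc).
by apply: eq_measure_integral => A mA _; exact: gaussian_coord.
Qed.

Lemma gaussian_integral_prod (h : 'I_d -> R -> R) :
  (forall i, measurable_fun setT (h i)) -> (forall i x, (0 <= h i x)%R) ->
  (forall i, \int[N01]_x (h i x)%:E < +oo) ->
  \int[P]_w (\prod_i h i (tnth (Z w) i))%:E = \prod_i \int[N01]_x (h i x)%:E.
Proof.
move=> mh h0 hoo.
have E i : \int[N01]_x (h i x)%:E = \int[P]_w (h i (tnth (Z w) i))%:E.
  rewrite (gaussian_coord_integral i (h := EFin \o h i))//.
    exact/measurable_EFinP.
  by move=> x; rewrite lee_fin.
under [RHS]eq_bigr do rewrite E.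
apply: (@independent_expectation_prod _ _ _ P _ _ (fun=> R)
    (fun i w => tnth (Z w) i) mcoord (fun=> measurable)) => //.
- by move=> i; exact: measurable_sigma_algebraE.
- by move=> i A B; exact: measurableI.
- move=> A mA; rewrite gZ//; apply: eq_bigr => i _; apply/esym.
  exact: gaussian_coord.
- by move=> i; rewrite -E.
Qed.

(** The density of [N(v, I_d)] with respect to [N(0, I_d)]. *)
Definition gaussian_lr (v : 'I_d -> R) (z : d.-tuple R) : R :=
  (\prod_i expR (v i * tnth z i - v i ^+ 2 / 2))%R.

Lemma gaussian_lr_ge0 v z : (0 <= gaussian_lr v z)%R.
Proof. by rewrite prodr_ge0// => i _; exact: expR_ge0. Qed.

Lemma measurable_gaussian_lr v : measurable_fun setT (gaussian_lr v).
Proof.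
apply: measurable_prod => i _; apply: measurableT_comp => //.
apply: measurable_funB => //; apply: measurable_funM => //.
exact: measurable_tnth.
Qed.

Let lr v (x : R) : R := expR (v * x - v ^+ 2 / 2).

Let mlr v : measurable_fun setT (lr v).
Proof. by apply: measurableT_comp => //; exact: measurable_funB. Qed.

Let preimage_add_measurable v (A : set R) : measurable A ->
  measurable ((fun x => (x + v)%R) @^-1` A).
Proof.
move=> mA; rewrite -[X in measurable X]setTI.
have : measurable_fun setT (fun x : R => (x + v)%R) by exact: measurable_funD.
by move=> /(_ measurableT A mA).
Qed.

Let lr_indic v (A : set R) : measurable A ->
  \int[N01]_x (\1_A x * lr v x)%:E = N01 ((fun x => (x + v)%R) @^-1` A).
Proof.
move=> mA; have mA1 : measurable_fun setT (EFin \o (\1_A : R -> R)).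
  exact/measurable_EFinP.
have A0 x : 0 <= (EFin \o (\1_A : R -> R)) x by rewrite lee_fin.
have h := normal_shift v mA1 A0.
transitivity (\int[N01]_x ((EFin \o (\1_A : R -> R)) x * (expR (v * x - v ^+ 2 / 2))%:E)).
  by apply: eq_integral => x _; rewrite EFinM.
rewrite -h.
have mB : @measurable _ (measurableTypeR R) ((fun x => (x + v)%R) @^-1` A).
  exact: preimage_add_measurable.
rewrite -[X in N01 X]setIT -integral_indic//.
Qed.

Definition tuple_shift (v : 'I_d -> R) (z : d.-tuple R) : d.-tuple R :=
  [tuple (tnth z i + v i)%R | i < d].

Lemma measurable_tuple_shift v : measurable_fun setT (tuple_shift v).
Proof.
apply/measurable_fun_tnthP => i; rewrite /comp/=.
under eq_fun do rewrite tnth_mktuple.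
by apply: measurable_funD => //; exact: measurable_tnth.
Qed.

(** On boxes both sides factor over the coordinates and reduce to [normal_shift]; boxes determine
    the law of the shifted vector. *)
Lemma gaussian_shift (v : 'I_d -> R) (h : d.-tuple R -> \bar R) :
  measurable_fun setT h -> (forall z, 0 <= h z) ->
  \int[P]_w h (tuple_shift v (Z w)) =
  \int[P]_w (h (Z w) * (gaussian_lr v (Z w))%:E).
Proof.
move=> mh h0.
have ms : measurable_fun setT (fun w => tuple_shift v (Z w)).
  exact: measurableT_comp (measurable_tuple_shift v) mZ.
have mL : measurable_fun setT (fun w => gaussian_lr v (Z w)).
  exact: measurableT_comp (measurable_gaussian_lr v) mZ.
have L0 w : (0 <= gaussian_lr v (Z w))%R by exact: gaussian_lr_ge0.
have mhZ : measurable_fun setT (fun w => h (Z w)) by exact: measurableT_comp.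
rewrite -[RHS](ge0_integral_density P mL L0 mhZ)//.
rewrite -[LHS](@ge0_integral_pushforward _ _ _ _ _ _ ms P setT h)//.
rewrite -[RHS](@ge0_integral_pushforward _ _ _ _ _ _ mZ (density_measure P mL L0) setT h)//.
apply: eq_measure_integral => A mA _.
apply: (measure_unique (@box _ R d) (fun=> setT)) => //.
- exact: measurable_tupleE.
- exact: setI_closed_box.
- by move=> _; exact: box_setT.
- by rewrite bigcup_const.
- move=> _ [B mB ->]; rewrite /= /pushforward.
  have mB' i : measurable ((fun x => (x + v i)%R) @^-1` B i).
    exact: preimage_add_measurable.
  transitivity (P [set w | forall i, ((fun x => (x + v i)%R) @^-1` B i) (tnth (Z w) i)]).
    by congr (P _); apply/seteqP; split => w h' i; move: (h' i) => /=;
      rewrite tnth_mktuple.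
  rewrite (gZ mB'); under eq_bigr do rewrite -lr_indic//.
  rewrite -gaussian_integral_prod.
  + rewrite /density_measure [RHS]integral_mkcond; apply: eq_integral => w _.
    rewrite epatch_indic/= -EFinM big_split/= mulrC; congr (_ * _)%:E.
    rewrite indicE; have [wB|wB] := boolP (w \in _).
      rewrite big1// => i _; rewrite indicE mem_set//.
      by move: wB; rewrite inE; exact.
    move: wB; rewrite notin_setE/= => /existsNP[i Bi].
    by rewrite (bigD1 i)//= indicE memNset// mul0r.
  + by move=> i; exact: measurable_funM.
  + by move=> i x; rewrite mulr_ge0// expR_ge0.
  + by move=> i; rewrite lr_indic//; apply: le_lt_trans (ltry 1);
      exact: (@probability_le1 _ _ _ (normal_prob 0%R 1%R) _ (mB' i)).
- by move=> _; rewrite /= /pushforward preimage_setT probability_setT ltry.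
Qed.
End gaussian.

(** * Moments of the likelihood ratios and of their mixture *)

Section normal_moments.
Local Open Scope ereal_scope.
Context {R : realType}.
Local Notation N01 := (@normal_prob R 0%R 1%R).
Implicit Types (a b v w x k : R).

Lemma measurable_exp_affine (a b : R) :
  measurable_fun setT (fun x : R => expR (a * x + b)).
Proof. by apply: measurableT_comp => //; exact: measurable_funD. Qed.

Lemma normal_exp_affine (a b : R) :
  \int[N01]_x (expR (a * x + b))%:E = (expR (a ^+ 2 / 2 + b))%:E.
Proof.
transitivity (\int[N01]_x ((expR b)%:E * (expR (a * x))%:E)).
  by apply: eq_integral => x _; rewrite -EFinM -expRD addrC.
have m1 : measurable_fun setT (fun x : measurableTypeR R => (expR (a * x))%:E).
  by apply/measurable_EFinP; apply: measurableT_comp.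
by rewrite ge0_integralZl// normal_mgf -EFinM -expRD addrC.
Qed.

(** An entry is a coefficient followed by the slope and the intercept of an exponent; this form
    serves to expand the cube of the mixture. *)
Lemma normal_exp_affine_sum (s : seq (R * (R * R))) :
  (forall t, t \in s -> (0 <= t.1)%R) ->
  \int[N01]_x (\sum_(t <- s) t.1 * expR (t.2.1 * x + t.2.2))%:E =
  (\sum_(t <- s) t.1 * expR (t.2.1 ^+ 2 / 2 + t.2.2))%R%:E.
Proof.
elim: s => [|[k [a b]] s IH] s0.
  under eq_integral do rewrite big_nil.
  by rewrite big_nil integral0.
have s0' t : t \in s -> (0 <= t.1)%R by move=> ts; apply: s0; rewrite inE ts orbT.
have k0 : (0 <= k)%R by have := s0 (k, (a, b)); rewrite inE eqxx; exact.
have m1 : measurable_fun setT (fun x : measurableTypeR R => (k * expR (a * x + b))%:E).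
  by apply/measurable_EFinP; apply: measurable_funM => //; exact: measurable_exp_affine.
under eq_integral do rewrite big_cons EFinD/=.
rewrite big_cons ge0_integralD//.
- rewrite IH// EFinD; congr (_ + _).
  under eq_integral do rewrite EFinM.
  rewrite ge0_integralZl//.
  + by rewrite normal_exp_affine EFinM.
  + by apply/measurable_EFinP; exact: measurable_exp_affine.
- by move=> x _; rewrite lee_fin mulr_ge0// expR_ge0.
- move=> x _; rewrite lee_fin big_seq sumr_ge0// => t ts.
  by rewrite mulr_ge0// ?s0'// expR_ge0.
- apply/measurable_EFinP; apply: measurable_sum => t.
  by apply: measurable_funM => //; exact: measurable_exp_affine.
Qed.

Definition normal_lr v x := expR (v * x - v ^+ 2 / 2).

Lemma normal_lr_prod v w :
  \int[N01]_x (normal_lr v x * normal_lr w x)%:E = (expR (v * w))%:E.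
Proof.
transitivity (\int[N01]_x (expR ((v + w) * x + (- (v ^+ 2 + w ^+ 2) / 2)))%:E).
  by apply: eq_integral => x _; rewrite /normal_lr -expRD; congr (expR _)%:E; field.
by rewrite normal_exp_affine; congr (expR _)%:E; field.
Qed.

Definition normal_mixture_lr a x := ((normal_lr a x + normal_lr (- a) x) / 2)%R.

Lemma normal_mixture_lr_cube a :
  \int[N01]_x (normal_mixture_lr a x ^+ 3)%:E =
  ((expR (3 * a ^+ 2) + 3 * expR (- a ^+ 2)) / 4)%:E.
Proof.
(* Each of the three factors contributes [- a^2 / 2] to the intercept; the slopes and weights below
   are those of a binomial expansion. *)
pose c := (- (3 * a ^+ 2 / 2))%R.
transitivity (\int[N01]_x (\sum_(t <- [:: (1 / 8, (3 * a, c)); (3 / 8, (a, c));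
    (3 / 8, (- a, c)); (1 / 8, (- (3 * a), c))])
    t.1 * expR (t.2.1 * x + t.2.2))%:E).
  apply: eq_integral => x _; congr EFin.
  rewrite !big_cons big_nil/= /normal_mixture_lr /normal_lr.
  set p := expR (a * x - _); set q := expR (- a * x - _).
  have -> : expR (3 * a * x + c) = (p * p * p)%R.
    by rewrite /p -!expRD /c; congr expR; field.
  have -> : expR (a * x + c) = (p * p * q)%R.
    by rewrite /p /q -!expRD /c; congr expR; field.
  have -> : expR (- a * x + c) = (p * q * q)%R.
    by rewrite /p /q -!expRD /c; congr expR; field.
  have -> : expR (- (3 * a) * x + c) = (q * q * q)%R.
    by rewrite /p /q -!expRD /c; congr expR; field.
  by field.
rewrite normal_exp_affine_sum; last first.
  by move=> t; rewrite !inE => /or4P[] /eqP -> /=; lra.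
congr EFin; rewrite !big_cons big_nil/= /c.
rewrite (_ : (3 * a) ^+ 2 / 2 + _ = 3 * a ^+ 2)%R; last by field.
rewrite (_ : (- (3 * a)) ^+ 2 / 2 + _ = 3 * a ^+ 2)%R; last by field.
rewrite (_ : a ^+ 2 / 2 + _ = - a ^+ 2)%R; last by field.
rewrite (_ : (- a) ^+ 2 / 2 + _ = - a ^+ 2)%R; last by field.
by field.
Qed.

End normal_moments.

Section gaussian_mixture.
Local Open Scope ereal_scope.
Context dO (Omega : measurableType dO) (R : realType) (P : probability Omega R).
Context (d : nat) (Z : {RV P >-> d.-tuple R}).
Hypothesis gZ : standard_gaussian Z.
Local Notation N01 := (@normal_prob R 0%R 1%R).

Let mlr (v : R) : measurable_fun setT (@normal_lr R v).
Proof. by apply: measurableT_comp => //; exact: measurable_funB. Qed.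

Lemma gaussian_lr_prod (v w : 'I_d -> R) :
  \int[P]_x (gaussian_lr v (Z x) * gaussian_lr w (Z x))%:E =
  (\prod_i expR (v i * w i))%:E.
Proof.
transitivity (\int[P]_x (\prod_i (normal_lr (v i) (tnth (Z x) i) *
    normal_lr (w i) (tnth (Z x) i)))%:E).
  by apply: eq_integral => x _; rewrite big_split.
rewrite (gaussian_integral_prod gZ (h := fun i x => normal_lr (v i) x * normal_lr (w i) x)%R).
- by rewrite -prodEFin; apply: eq_bigr => i _; rewrite normal_lr_prod.
- by move=> i; exact: measurable_funM.
- by move=> i x; rewrite mulr_ge0// expR_ge0.
- by move=> i; rewrite normal_lr_prod ltry.
Qed.

Definition spike (a : R) (s : cube d) (i : 'I_d) : R :=
  if bit s i then a else (- a)%R.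

Definition mixture_lr (a : R) (z : d.-tuple R) : R :=
  cube_avg (fun s => gaussian_lr (spike a s) z).

(** The signs are independent under the uniform prior. This factorization makes the third moment a
    [d]-th power. *)
Lemma mixture_lrE (a : R) z : mixture_lr a z = (\prod_i normal_mixture_lr a (tnth z i))%R.
Proof.
pose F i (b : bool) : R := normal_lr (if b then a else (- a)%R) (nth 0%R z i).
rewrite (_ : mixture_lr a z = cube_avg (fun s : cube d => \prod_(i < d) F i (bit s i))%R).
  rewrite cube_avg_prod; apply: eq_bigr => i _.
  by rewrite /F /normal_mixture_lr (tnth_nth 0%R).
apply: eq_cube_avg => s; apply: eq_bigr => i _.
by rewrite /F /spike /normal_lr (tnth_nth 0%R).
Qed.

Lemma mixture_lr_ge0 a z : (0 <= mixture_lr a z)%R.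
Proof. by apply: cube_avg_ge0 => s; exact: gaussian_lr_ge0. Qed.

Lemma measurable_mixture_lr a : measurable_fun setT (mixture_lr a).
Proof.
apply: measurable_funM => //; apply: measurable_sum => s.
exact: measurable_gaussian_lr.
Qed.

Lemma mixture_lr_cube (a : R) :
  \int[P]_x (mixture_lr a (Z x) ^+ 3)%:E =
  (((expR (3 * a ^+ 2) + 3 * expR (- a ^+ 2)) / 4) ^+ d)%:E.
Proof.
have m0 i x : (0 <= normal_mixture_lr a x ^+ 3)%R :> Prop.
  by rewrite exprn_ge0// divr_ge0// addr_ge0// expR_ge0.
transitivity (\int[P]_x (\prod_i (normal_mixture_lr a (tnth (Z x) i)) ^+ 3)%:E).
  by apply: eq_integral => x _; rewrite mixture_lrE prodrXl.
rewrite (gaussian_integral_prod gZ (h := fun i x => normal_mixture_lr a x ^+ 3)%R).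
- under eq_bigr do rewrite normal_mixture_lr_cube.
  by rewrite prodEFin prodr_const card_ord.
- move=> i; apply: measurable_funX; apply: measurable_funM => //.
  by apply: measurable_funD; exact: mlr.
- by move=> i x; rewrite exprn_ge0// divr_ge0// addr_ge0// expR_ge0.
- by move=> i; rewrite normal_mixture_lr_cube ltry.
Qed.

Lemma gaussian_lr_integral (v : 'I_d -> R) :
  \int[P]_x (gaussian_lr v (Z x))%:E = 1.
Proof.
have := gaussian_lr_prod v (fun=> 0%R).
rewrite [in RHS]big1 => [<-|i _]; last by rewrite mulr0 expR0.
apply: eq_integral => x _; rewrite [X in (_ * X)%R]big1 ?mulr1// => i _.
by rewrite mul0r expr0n/= mul0r subr0 expR0.
Qed.

Lemma cube_avg_integral (F : cube d -> Omega -> R) (c : cube d -> R) :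
  (forall s, measurable_fun setT (F s)) -> (forall s x, (0 <= F s x)%R) ->
  (forall s, \int[P]_x (F s x)%:E = (c s)%:E) ->
  \int[P]_x (cube_avg (F ^~ x))%:E = (cube_avg c)%:E.
Proof.
move=> mF F0 Fc.
have c0 : (0 <= (2 ^+ d)^-1 :> R)%R by rewrite invr_ge0 exprn_ge0.
have mFE s : measurable_fun setT (fun x => (F s x)%:E) by exact/measurable_EFinP.
have FE0 s x : setT x -> 0 <= (F s x)%:E by rewrite lee_fin.
under eq_integral do rewrite /cube_avg EFinM -sumEFin.
rewrite ge0_integralZl//.
- rewrite (ge0_integral_sum _ measurableT mFE FE0).
  by rewrite /cube_avg EFinM -sumEFin; under eq_bigr do rewrite Fc.
- exact: emeasurable_sum.
- by move=> x _; apply: sume_ge0 => s _; rewrite lee_fin.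
Qed.

Lemma mixture_lr_integral (a : R) : \int[P]_x (mixture_lr a (Z x))%:E = 1.
Proof.
rewrite (cube_avg_integral (F := fun s x => gaussian_lr (spike a s) (Z x)) (c := fun=> 1%R)).
- by rewrite cube_avg_cst.
- move=> s; apply: measurableT_comp; first exact: measurable_gaussian_lr.
  exact: measurable_funP.
- by move=> s x; exact: gaussian_lr_ge0.
- by move=> s; rewrite gaussian_lr_integral.
Qed.

(** Expanding the square as a double average, [gaussian_lr_prod] evaluates the pair [(s, t)] to
    [exp (a^2 <s, t>)], which is the kernel of [cube_form]. *)
Lemma mixture_lr_sqr (a : R) (q : cube d -> R) : (forall s, (0 <= q s)%R) ->
  \int[P]_x (cube_avg (fun s => q s * gaussian_lr (spike a s) (Z x))%R ^+ 2)%:E =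
  (cube_form (expR (a ^+ 2)) (expR (- a ^+ 2)) q q)%:E.
Proof.
move=> q0.
have mL s : measurable_fun setT (fun x => gaussian_lr (spike a s) (Z x)).
  apply: measurableT_comp; first exact: measurable_gaussian_lr.
  exact: measurable_funP.
have L0 s x : (0 <= gaussian_lr (spike a s) (Z x))%R by exact: gaussian_lr_ge0.
transitivity (\int[P]_x (cube_avg (fun s => cube_avg (fun t =>
    q s * q t * (gaussian_lr (spike a s) (Z x) * gaussian_lr (spike a t) (Z x)))%R))%:E).
  apply: eq_integral => x _; congr EFin; rewrite expr2 -cube_avgZ.
  apply: eq_cube_avg => s; rewrite mulrC -cube_avgZ; apply: eq_cube_avg => t.
  by ring.
have mq s t : measurable_fun setT (fun x =>
    q s * q t * (gaussian_lr (spike a s) (Z x) * gaussian_lr (spike a t) (Z x)))%R.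
  by apply: measurable_funM => //; exact: measurable_funM.
have q0' s t x : (0 <= q s * q t *
    (gaussian_lr (spike a s) (Z x) * gaussian_lr (spike a t) (Z x)))%R.
  by rewrite !mulr_ge0.
apply: (cube_avg_integral (F := fun s x => cube_avg (fun t =>
    q s * q t * (gaussian_lr (spike a s) (Z x) * gaussian_lr (spike a t) (Z x)))%R)).
- by move=> s; apply: measurable_funM => //; exact: measurable_sum.
- by move=> s x; exact: cube_avg_ge0.
move=> s.
apply: (cube_avg_integral (F := fun t x =>
    q s * q t * (gaussian_lr (spike a s) (Z x) * gaussian_lr (spike a t) (Z x)))%R).
- by move=> t; exact: mq.
- by move=> t x; exact: q0'.
move=> t; under eq_integral do rewrite EFinM.
rewrite ge0_integralZl//.
- rewrite gaussian_lr_prod -EFinM; congr (_ * _)%:E; apply: eq_bigr => i _.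
  rewrite /spike /sign_kernel; case: (bit s i); case: (bit t i) => /=;
    by congr expR; ring.
- by apply/measurable_EFinP; exact: measurable_funM.
- by move=> x _; rewrite lee_fin mulr_ge0.
- by rewrite lee_fin mulr_ge0.
Qed.

End gaussian_mixture.

(** * A single machine under the prior *)

Section real_inequality.
Context {R : realType}.

(* The Cauchy-Schwarz inequality follows from its linearized form by optimizing
   over [t]. *)
Lemma sqr_le_of_linearized (x A r : R) : 0 <= x -> 0 <= A -> 0 <= r ->
  (forall t, 0 < t -> 2 * x <= t * A + r / t) -> x ^+ 2 <= r * A.
Proof.
rewrite le_eqVlt => /predU1P[<- A0 r0 _|x0].
  by rewrite expr0n/= mulr_ge0.
rewrite le_eqVlt => /predU1P[<- r0|A0 r0] H.
  (* For [A = 0], this [t] makes the right-hand side [r x / (r + 1) <= x], in contradiction with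
     [x > 0]. *)
  have t0 : 0 < (r + 1) / x by rewrite divr_gt0//; lra.
  have := H _ t0; rewrite mulr0 add0r invf_div mulrA => h.
  have : r * x / (r + 1) <= x by rewrite ler_pdivrMr; nra.
  lra.
have := H _ (divr_gt0 x0 A0); rewrite divfK ?gt_eqF// invf_div mulrA => h.
have : x <= r * A / x by lra.
by rewrite ler_pdivlMr.
Qed.

End real_inequality.

Section machine.
Local Open Scope ereal_scope.
Context dO (Omega : measurableType dO) (R : realType) (P : probability Omega R).
Context (d : nat) (Z : {RV P >-> d.-tuple R}).
Hypothesis gZ : standard_gaussian Z.

Let mZ : measurable_fun setT Z. Proof. exact: measurable_funP. Qed.

Section auxiliary_variable.
Context dU (TU : measurableType dU) (U : {RV P >-> TU}).
Hypothesis ZU : forall A B, measurable A -> measurable B ->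
  P (Z @^-1` A `&` U @^-1` B) = P (Z @^-1` A) * P (U @^-1` B).

Let mU : measurable_fun setT U. Proof. exact: measurable_funP. Qed.

Lemma gaussian_shift_pair (v : 'I_d -> R) (g : d.-tuple R * TU -> R) :
  measurable_fun setT g -> (forall x, (0 <= g x)%R) ->
  \int[P]_w (g (tuple_shift v (Z w), U w))%:E =
  \int[P]_w (g (Z w, U w) * gaussian_lr v (Z w))%:E.
Proof.
move=> mg g0.
have mh1 : measurable_fun setT (fun x : d.-tuple R * TU => (g (tuple_shift v x.1, x.2))%:E).
  apply/measurable_EFinP; apply: measurableT_comp => //.
  apply: measurable_fun_pair => //.
  by apply: measurableT_comp => //; exact: measurable_tuple_shift.
have mh2 : measurable_fun setT (fun x : d.-tuple R * TU => (g x * gaussian_lr v x.1)%:E).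
  apply/measurable_EFinP; apply: measurable_funM => //.
  by apply: measurableT_comp => //; exact: measurable_gaussian_lr.
have mT : @measurable _ (d.-tuple R) = <<s measurable >>.
  exact: measurable_sigma_algebraE.
have GI : setI_closed (@measurable _ (d.-tuple R)) by move=> A B; exact: measurableI.
rewrite (independent_pair_integral mZ mU mT GI measurableT ZU mh1); last first.
  by move=> x; rewrite lee_fin.
rewrite (independent_pair_integral mZ mU mT GI measurableT ZU mh2); last first.
  by move=> x; rewrite lee_fin mulr_ge0// gaussian_lr_ge0.
apply: eq_integral => w _ /=.
rewrite (gaussian_shift gZ v (h := fun z => (g (z, U w))%:E)).
- by apply: eq_integral => w' _; rewrite EFinM.
- by apply/measurable_EFinP; apply: measurableT_comp => //; exact: measurable_pair2.
- by move=> z; rewrite lee_fin.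
Qed.

(* The pointwise hypothesis relates the statistic [y] to the e-value [g] at
   likelihood ratio [l]; integrated against the mixture, it bounds the average
   of the means of [y] over the prior. *)
Lemma mixture_mean_le (a k1 k2 k3 k4 : R) (y g : d.-tuple R * TU -> R) :
  measurable_fun setT y -> (forall x, (0 <= y x)%R) ->
  measurable_fun setT g -> (forall x, (0 <= g x)%R) ->
  \int[P]_w (g (Z w, U w))%:E <= 1 ->
  (0 <= k1)%R -> (0 <= k2)%R -> (0 <= k3)%R -> (0 <= k4)%R ->
  (forall x (l : R), (0 <= l)%R ->
     (y x * l + k1 * l <= k2 * g x + k3 * l ^+ 3 + k4)%R) ->
  exists c : cube d -> R,
    [/\ forall s, \int[P]_w (y (tuple_shift (spike a s) (Z w), U w))%:E = (c s)%:E
      & (cube_avg c <= k2 + k3 * third_moment (a ^+ 2) d + k4 - k1)%R].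
Proof.
move=> my y0 mg g0 g1 k10 k20 k30 k40 ylg.
have mW : measurable_fun setT (fun w => (Z w, U w)) by exact: measurable_fun_pair.
have myW : measurable_fun setT (fun w => y (Z w, U w)) by exact: measurableT_comp.
have mgW : measurable_fun setT (fun w => g (Z w, U w)) by exact: measurableT_comp.
have mL : measurable_fun setT (fun w => mixture_lr a (Z w)).
  by apply: measurableT_comp => //; exact: measurable_mixture_lr.
have L0 w : (0 <= mixture_lr a (Z w))%R by exact: mixture_lr_ge0.
pose I s := \int[P]_w (y (tuple_shift (spike a s) (Z w), U w))%:E.
have mlr s : measurable_fun setT (fun w => gaussian_lr (spike a s) (Z w)).
  by apply: measurableT_comp => //; exact: measurable_gaussian_lr.
have lr0 s w : (0 <= gaussian_lr (spike a s) (Z w))%R by exact: gaussian_lr_ge0.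
have IE s : I s = \int[P]_w (y (Z w, U w) * gaussian_lr (spike a s) (Z w))%:E.
  exact: gaussian_shift_pair.
pose J := \int[P]_w (y (Z w, U w) * mixture_lr a (Z w))%:E.
(* The pointwise hypothesis is taken at [l = L(Z)] and integrated: [L] has mean 1 and third moment
   [third_moment (a ^+ 2) d]. *)
have JB : J + k1%:E <= (k2 + k3 * third_moment (a ^+ 2) d + k4)%:E.
  have -> : J + k1%:E = \int[P]_w (y (Z w, U w) * mixture_lr a (Z w) + k1 * mixture_lr a (Z w))%:E.
    under [RHS]eq_integral do rewrite EFinD.
    rewrite ge0_integralD//.
    - congr (_ + _); under eq_integral do rewrite EFinM.
      rewrite ge0_integralZl//.
      + by rewrite mixture_lr_integral// mule1.
      + exact/measurable_EFinP.
      + by move=> w _; rewrite lee_fin.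
    - by move=> w _; rewrite lee_fin mulr_ge0.
    - by apply/measurable_EFinP; exact: measurable_funM.
    - by move=> w _; rewrite lee_fin mulr_ge0.
    - by apply/measurable_EFinP; exact: measurable_funM.
  apply: (@le_trans _ _ (\int[P]_w (k2 * g (Z w, U w) + k3 * mixture_lr a (Z w) ^+ 3 + k4)%:E)).
    apply: ge0_le_integral => //.
    - by move=> w _; rewrite lee_fin addr_ge0// mulr_ge0.
    - by apply/measurable_EFinP; apply: measurable_funD; exact: measurable_funM.
    - apply/measurable_EFinP; apply: measurable_funD => //.
      apply: measurable_funD; apply: measurable_funM => //.
      exact: measurable_funX.
    - by move=> w _; rewrite lee_fin ylg.
  under eq_integral do rewrite !EFinD.
  rewrite ge0_integralD//; last 2 first.
  - by move=> w _; rewrite adde_ge0// lee_fin mulr_ge0// exprn_ge0.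
  - apply: emeasurable_funD; apply/measurable_EFinP; apply: measurable_funM => //.
    exact: measurable_funX.
  rewrite ge0_integralD//; last 4 first.
  - by move=> w _; rewrite lee_fin mulr_ge0.
  - by apply/measurable_EFinP; exact: measurable_funM.
  - by move=> w _; rewrite lee_fin mulr_ge0// exprn_ge0.
  - by apply/measurable_EFinP; apply: measurable_funM => //; exact: measurable_funX.
  rewrite integral_cst// [X in k4%:E * X](_ : _ = 1); last exact: probability_setT.
  rewrite mule1 !EFinD.
  apply: leeD => //; apply: leeD.
    under eq_integral do rewrite EFinM.
    rewrite ge0_integralZl//; last 2 first.
    - exact/measurable_EFinP.
    - by move=> w _; rewrite lee_fin.
    by rewrite -[leRHS]mule1 lee_wpmul2l// lee_fin.
  under eq_integral do rewrite EFinM.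
  rewrite ge0_integralZl//; last 2 first.
  - by apply/measurable_EFinP; exact: measurable_funX.
  - by move=> w _; rewrite lee_fin exprn_ge0.
  by rewrite mixture_lr_cube// EFinM.
have J0 : 0 <= J by apply: integral_ge0 => w _; rewrite lee_fin mulr_ge0.
have Jfin : J \is a fin_num.
  rewrite ge0_fin_numE//; apply: le_lt_trans (ltry (k2 + k3 * third_moment (a ^+ 2) d + k4)).
  by apply: le_trans JB; rewrite leeDl// lee_fin.
(* Each signal has prior weight [2^(- d)], so each single mean is at most [2^d J]. *)
have Ifin s : I s = (fine (I s))%:E.
  rewrite fineK// ge0_fin_numE; last by apply: integral_ge0 => w _; rewrite lee_fin.
  apply: (@le_lt_trans _ _ ((2 ^+ d)%:E * J)); last first.
    by rewrite -(fineK Jfin) -EFinM ltry.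
  rewrite IE /J -ge0_integralZl//; last 2 first.
  - by apply/measurable_EFinP; exact: measurable_funM.
  - by move=> w _; rewrite lee_fin mulr_ge0.
  apply: ge0_le_integral => //.
  - by move=> w _; rewrite lee_fin mulr_ge0.
  - by apply/measurable_EFinP; exact: measurable_funM.
  - by apply: emeasurable_funM => //; apply/measurable_EFinP; exact: measurable_funM.
  - move=> w _; rewrite -EFinM lee_fin mulrCA ler_wpM2l// /mixture_lr /cube_avg.
    rewrite mulrA mulfV ?mul1r ?expf_neq0//.
    by rewrite (bigD1 s)//= lerDl sumr_ge0.
exists (fun s => fine (I s)); split => //.
have JE : J = (cube_avg (fun s => fine (I s)))%:E.
  rewrite -(cube_avg_integral (P := P)
    (F := fun s w => y (Z w, U w) * gaussian_lr (spike a s) (Z w))%R).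
  - by apply: eq_integral => w _; rewrite cube_avgZ.
  - by move=> s; exact: measurable_funM.
  - by move=> s w; rewrite mulr_ge0.
  - by move=> s; rewrite -IE -Ifin.
by move: JB; rewrite JE -EFinD lee_fin lerBrDr.
Qed.

End auxiliary_variable.


(** The average of [q s * G s] is the null mean of [sqrt g] times the [q]-weighted likelihood ratio.
    By Cauchy-Schwarz its square is at most the mean of [g] times the second moment given by
    [mixture_lr_sqr]. *)
Lemma mixture_sqrt_mean (a r : R) (g : d.-tuple R -> R) :
  measurable_fun setT g -> (forall z, (0 <= g z)%R) ->
  \int[P]_w (g (Z w))%:E = r%:E ->
  exists G : cube d -> R,
    [/\ forall s, \int[P]_w (g (tuple_shift (spike a s) (Z w)) `^ 2^-1)%:E = (G s)%:E,
        forall s, (0 <= G s)%R &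
        forall q, (forall s, (0 <= q s)%R) ->
          (cube_avg (fun s => q s * G s) ^+ 2 <=
           r * cube_form (expR (a ^+ 2)) (expR (- a ^+ 2)) q q)%R].
Proof.
move=> mg g0 gr; pose y z := (g z `^ 2^-1)%R.
have y0 z : (0 <= y z)%R by exact: powR_ge0.
have y2 z : (y z ^+ 2 = g z)%R.
  by rewrite /y -powR_mulrn ?powR_ge0// -powRrM mulVf// powRr1.
have my : measurable_fun setT y.
  exact: (measurableT_comp (measurable_powR _) mg).
have myZ : measurable_fun setT (fun w => y (Z w)) by exact: measurableT_comp.
have mgZ : measurable_fun setT (fun w => g (Z w)) by exact: measurableT_comp.
have mlr s : measurable_fun setT (fun w => gaussian_lr (spike a s) (Z w)).
  by apply: measurableT_comp => //; exact: measurable_gaussian_lr.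
have lr0 s w : (0 <= gaussian_lr (spike a s) (Z w))%R by exact: gaussian_lr_ge0.
have r0 : (0 <= r)%R.
  by rewrite -lee_fin -gr; apply: integral_ge0 => w _; rewrite lee_fin.
pose I s := \int[P]_w (y (tuple_shift (spike a s) (Z w)))%:E.
have IE s : I s = \int[P]_w (y (Z w) * gaussian_lr (spike a s) (Z w))%:E.
  rewrite /I (gaussian_shift gZ _ (h := EFin \o y)).
  - by apply: eq_integral => w _; rewrite EFinM.
  - exact/measurable_EFinP.
  - by move=> z; rewrite lee_fin.
pose L q w : R := cube_avg (fun s => q s * gaussian_lr (spike a s) (Z w))%R.
pose form q := cube_form (expR (a ^+ 2)) (expR (- a ^+ 2)) (q : cube d -> R) q.
have mL q : measurable_fun setT (L q).
  apply: measurable_funM => //; apply: measurable_sum => s.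
  exact: measurable_funM.
have L0 q w : (forall s, (0 <= q s)%R) -> (0 <= L q w)%R.
  by move=> q0; apply: cube_avg_ge0 => s; rewrite mulr_ge0.
pose J q := \int[P]_w (y (Z w) * L q w)%:E.
have J2 q t : (forall s, (0 <= q s)%R) -> (0 < t)%R ->
    2%:E * J q <= (t * form q + r / t)%:E.
  move=> q0 t0; rewrite /J -ge0_integralZl//; last 2 first.
  - by apply/measurable_EFinP; exact: measurable_funM.
  - by move=> w _; rewrite lee_fin mulr_ge0// L0.
  apply: (@le_trans _ _ (\int[P]_w (t * L q w ^+ 2 + t^-1 * g (Z w))%:E)).
    apply: ge0_le_integral => //.
    - by move=> w _; rewrite mule_ge0// lee_fin mulr_ge0// L0.
    - apply: emeasurable_funM => //; apply/measurable_EFinP.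
      exact: measurable_funM.
    - apply/measurable_EFinP; apply: measurable_funD; apply: measurable_funM => //.
      exact: measurable_funX.
    - move=> w _; rewrite -EFinM lee_fin -y2.
      set u := y _; set l := L _ _; rewrite -subr_ge0.
      have -> : (t * l ^+ 2 + t^-1 * u ^+ 2 - 2 * (u * l) = t^-1 * (t * l - u) ^+ 2)%R.
        by field; rewrite gt_eqF.
      by rewrite mulr_ge0 ?sqr_ge0// invr_ge0 ltW.
  under eq_integral do rewrite EFinD (EFinM t) (EFinM t^-1).
  have t_ge0 := ltW t0.
  rewrite ge0_integralD//; last 4 first.
  - by move=> w _; rewrite mule_ge0// lee_fin sqr_ge0.
  - by apply: emeasurable_funM => //; apply/measurable_EFinP; exact: measurable_funX.
  - by move=> w _; rewrite mule_ge0// lee_fin// invr_ge0.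
  - by apply: emeasurable_funM => //; exact/measurable_EFinP.
  rewrite ge0_integralZl//; last 2 first.
  - by apply/measurable_EFinP; exact: measurable_funX.
  - by move=> w _; rewrite lee_fin sqr_ge0.
  rewrite mixture_lr_sqr// ge0_integralZl//; last 3 first.
  - exact/measurable_EFinP.
  - by move=> w _; rewrite lee_fin.
  - by rewrite lee_fin invr_ge0.
  by rewrite gr -!EFinM -EFinD lee_fin (mulrC r).
have Jfin q : (forall s, (0 <= q s)%R) -> J q \is a fin_num.
  move=> q0; have JJ0 : 0 <= J q.
    by apply: integral_ge0 => w _; rewrite lee_fin mulr_ge0// L0.
  rewrite ge0_fin_numE//; apply: le_lt_trans (ltry (1 * form q + r / 1)).
  apply: le_trans (J2 _ _ q0 ltr01).
  by rewrite -[leLHS]mul1e lee_wpmul2r// lee_fin ler1n.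
have Ifin s : I s = (fine (I s))%:E.
  have q0 : forall s : cube d, (0 <= (fun=> 1%R : R) s)%R by move=> ?; exact: ler01.
  rewrite fineK// ge0_fin_numE; last by apply: integral_ge0 => w _; rewrite lee_fin.
  apply: (@le_lt_trans _ _ ((2 ^+ d)%:E * J (fun=> 1%R))); last first.
    by rewrite -(fineK (Jfin _ q0)) -EFinM ltry.
  rewrite IE /J -ge0_integralZl//; last 2 first.
  - by apply/measurable_EFinP; exact: measurable_funM.
  - by move=> w _; rewrite lee_fin mulr_ge0// L0.
  apply: ge0_le_integral => //.
  - by move=> w _; rewrite lee_fin mulr_ge0.
  - by apply/measurable_EFinP; exact: measurable_funM.
  - by apply: emeasurable_funM => //; apply/measurable_EFinP; exact: measurable_funM.
  - move=> w _; rewrite -EFinM lee_fin mulrCA ler_wpM2l// /L /cube_avg.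
    rewrite mulrA mulfV ?mul1r ?expf_neq0//.
    by rewrite (bigD1 s)//= mul1r lerDl sumr_ge0// => t _; rewrite mulr_ge0.
exists (fun s => fine (I s)); split => //.
  by move=> s; rewrite fine_ge0//; apply: integral_ge0 => w _; rewrite lee_fin.
move=> q q0.
have JE : J q = (cube_avg (fun s => q s * fine (I s))%R)%:E.
  rewrite -(cube_avg_integral (P := P)
    (F := fun s w => q s * (y (Z w) * gaussian_lr (spike a s) (Z w)))%R).
  - apply: eq_integral => w _; rewrite -cube_avgZ; congr EFin.
    by apply: eq_cube_avg => s; rewrite mulrCA.
  - by move=> s; apply: measurable_funM => //; exact: measurable_funM.
  - by move=> s w; rewrite !mulr_ge0.
  - move=> s; under eq_integral do rewrite EFinM.
    rewrite ge0_integralZl//.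
    + by rewrite -IE {1}Ifin.
    + by apply/measurable_EFinP; exact: measurable_funM.
    + by move=> w _; rewrite lee_fin mulr_ge0.
    + by rewrite lee_fin.
apply: sqr_le_of_linearized => //.
- apply: cube_avg_ge0 => s; rewrite mulr_ge0// fine_ge0//.
  by apply: integral_ge0 => w _; rewrite lee_fin.
- apply: cube_avg_ge0 => s; apply: cube_avg_ge0 => t.
  rewrite mulr_ge0 ?mulr_ge0// prodr_ge0// => i _.
  by rewrite /sign_kernel; case: ifP => _; exact: expR_ge0.
- by move=> t t0; have := J2 q t q0 t0; rewrite JE -EFinM lee_fin.
Qed.

End machine.

(** * Product rules for mutually independent families *)

Section mutual_independence.
Local Open Scope ereal_scope.
Context dO (Omega : measurableType dO) (R : realType) (P : probability Omega R)
  (I J : finType) (dS : I -> measure_display) (S : forall i, measurableType (dS i))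
  (dT : J -> measure_display) (T : forall j, measurableType (dT j))
  (Y : forall i, {RV P >-> S i}) (V : forall j, {RV P >-> T j}).
Hypothesis YV : mutually_independent Y V.

Let PT : P setT = 1. Proof. exact: probability_setT. Qed.

Lemma mutually_independentl (A : forall i, set (S i)) :
  (forall i, measurable (A i)) ->
  P [set w | forall i, A i (Y i w)] = \prod_i P (Y i @^-1` A i).
Proof.
move=> mA; have := YV mA (fun j => @measurableT _ (T j)).
rewrite [X in _ * X]big1 => [|j _]; last by rewrite preimage_setT PT.
rewrite mule1 => <-; congr (P _).
by apply/seteqP; split => [w h|w []].
Qed.

Lemma mutually_independent_pair i j A B : measurable A -> measurable B ->
  P (Y i @^-1` A `&` V j @^-1` B) = P (Y i @^-1` A) * P (V j @^-1` B).
Proof.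
move=> mA mB.
pose A' := eqtype.dfwith (fun k => @setT (S k)) A.
pose B' := eqtype.dfwith (fun k => @setT (T k)) B.
have mA' k : measurable (A' k).
  by rewrite /A'; case: eqtype.dfwithP => // l _; exact: measurableT.
have mB' k : measurable (B' k).
  by rewrite /B'; case: eqtype.dfwithP => // l _; exact: measurableT.
have := YV mA' mB'.
rewrite (bigD1 i)//= big1 ?mule1; last first.
  by move=> k ki; rewrite /A' eqtype.dfwith_out 1?eq_sym// preimage_setT PT.
rewrite (bigD1 j)//= big1 ?mule1; last first.
  by move=> k kj; rewrite /B' eqtype.dfwith_out 1?eq_sym// preimage_setT PT.
rewrite /A' /B' !eqtype.dfwith_in => <-; congr (P _).
apply/seteqP; split => [w [wA wB]|w [/(_ i) + /(_ j)]]; last by rewrite !eqtype.dfwith_in.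
by split=> k; case: eqtype.dfwithP.
Qed.

End mutual_independence.

Section independent_pairs.
Local Open Scope ereal_scope.
Context dO (Omega : measurableType dO) (R : realType) (P : probability Omega R)
  (I : finType) (dS : I -> measure_display) (S : forall i, measurableType (dS i))
  (dT : I -> measure_display) (T : forall i, measurableType (dT i))
  (Y : forall i, {RV P >-> S i}) (V : forall i, {RV P >-> T i}).
Hypothesis YV : mutually_independent Y V.

(** Rectangles form a generating pi-system on each product space, and the joint product rule for
    rectangles regroups by pairs. *)
Lemma independent_pairs_expectation_prod (h : forall i, S i * T i -> R) :
  (forall i, measurable_fun setT (h i)) -> (forall i x, (0 <= h i x)%R) ->
  (forall i, \int[P]_w (h i (Y i w, V i w))%:E < +oo) ->
  \int[P]_w (\prod_i h i (Y i w, V i w))%:E =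
  \prod_i \int[P]_w (h i (Y i w, V i w))%:E.
Proof.
pose G i : set (set (S i * T i)) :=
  [set A `*` B | A in measurable & B in measurable].
move=> mh h0 hoo; apply: (@independent_expectation_prod _ _ _ P I _
    (fun i => (S i * T i)%type) (fun i w => (Y i w, V i w)) _ G) => //.
- by move=> i; apply: measurable_fun_pair; exact: measurable_funP.
- by move=> i; rewrite measurable_prod_measurableType.
- move=> i _ _ [A mA [B mB <-]] [A' mA' [B' mB' <-]]; rewrite -setXI.
  exists (A `&` A'); first exact: measurableI.
  by exists (B `&` B') => //; exact: measurableI.
- by move=> i; exists setT => //; exists setT => //; rewrite setXTT.
move=> C GC.
pose A i := s2val (cid2 (GC i)).
have mA i : measurable (A i) by exact: (s2valP (cid2 (GC i))).
pose BC i := cid2 (s2valP' (cid2 (GC i))).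
pose B i := s2val (BC i).
have mB i : measurable (B i) by exact: (s2valP (BC i)).
have CE i : C i = A i `*` B i by rewrite -(s2valP' (BC i)).
transitivity (P [set w | (forall i, A i (Y i w)) /\ (forall i, B i (V i w))]).
  congr (P _); apply/seteqP; split => [w wC|w [wA wB] i].
    by split => i; have := wC i; rewrite CE => -[].
  by rewrite CE; split; [exact: wA|exact: wB].
rewrite YV// -big_split/=; apply: eq_bigr => i _; rewrite CE.
by rewrite -(mutually_independent_pair YV).
Qed.

End independent_pairs.

(** * From one signal to the worst case, and numerical inequalities *)

Section worst_case.
Local Open Scope ereal_scope.
Context dO (Omega : measurableType dO) (R : realType) (P : probability Omega R).

Lemma markov_event (k : R) (S : set Omega) (Phi : Omega -> \bar R) :
  measurable S -> measurable_fun setT Phi -> (forall w, 0 <= Phi w) ->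
  (0 <= k)%R -> (forall w, S w -> k%:E <= Phi w) -> k%:E * P S <= \int[P]_w Phi w.
Proof.
move=> mS mPhi Phi0 k0 SPhi.
rewrite -[X in P X]setIT -integral_indic// -ge0_integralZl//; last first.
  exact/measurable_EFinP.
apply: ge0_le_integral => //.
- by move=> w _; rewrite mule_ge0// lee_fin.
- by apply: emeasurable_funM => //; exact/measurable_EFinP.
- move=> w _; rewrite indicE; have [|_] := boolP (w \in S).
    by rewrite inE mule1 => /SPhi.
  by rewrite mule0.
Qed.

Lemma worst_type_II_error_ge (alpha p rho : R) (C : combination) (m d : nat)
    (E : d.-tuple R -> 'I_m -> Omega -> R) (f : d.-tuple R) :
  H_ rho f -> measurable [set w | (alpha^-1 <= combine C (fun j => E f j w))%R] ->
  P [set w | (alpha^-1 <= combine C (fun j => E f j w))%R] <= p%:E ->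
  (1 - p)%:E <= worst_type_II_error P alpha C rho E.
Proof.
move=> Hf mS PS; apply: ereal_sup_ge.
exists (P [set w | threshold_test alpha C (fun j => E f j w) = 0%N]).
  by exists f.
rewrite (_ : [set w | _] =
    ~` [set w | (alpha^-1 <= combine C (fun j => E f j w))%R]); last first.
  by apply/seteqP; split => w; rewrite /= /threshold_test; case: ifP.
by rewrite probability_setC// EFinB leeB.
Qed.

Lemma measurable_combine (C : combination) (m : nat) (E : 'I_m -> Omega -> R) :
  (forall j, measurable_fun setT (E j)) ->
  measurable_fun setT (fun w => combine C (fun j => E j w)).
Proof.
move=> mE; case: C => /=.
  by apply: measurable_funM => //; exact: measurable_sum.
by apply: measurable_prod => j _; exact: mE.
Qed.

Lemma measurable_ge_event (x : R) (f : Omega -> R) : measurable_fun setT f ->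
  measurable [set w | (x <= f w)%R].
Proof.
move=> mf; rewrite (_ : [set w | _] = f @^-1` `[x, +oo[%classic).
  by rewrite -[X in measurable X]setTI; exact: mf.
by apply/seteqP; split => w /=; rewrite in_itv/= andbT.
Qed.

End worst_case.

Section spiked_signal.
Context {R : realType}.
Variables (n d : nat) (rho : R).
Hypotheses (n0 : (0 < n)%N) (d0 : (0 < d)%N) (rho0 : 0 < rho).

Definition spiked_signal (s : cube d) : d.-tuple R :=
  [tuple spike (rho / Num.sqrt d%:R) s i | i < d].

(** Rescaling the observation by [sqrt n] turns a signal [f] into the shift [sqrt n f] of standard
    noise. The square of this height is [b]. *)
Definition spike_height : R := Num.sqrt n%:R * rho / Num.sqrt d%:R.

Lemma spiked_signal_H s : H_ rho (spiked_signal s).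
Proof.
rewrite /H_ /= /l2norm.
have dR : 0 < d%:R :> R by rewrite ltr0n.
rewrite (eq_bigr (fun=> (rho / Num.sqrt d%:R) ^+ 2)); last first.
  by move=> i _; rewrite tnth_mktuple /spike; case: ifP => // _; rewrite sqrrN.
rewrite sumr_const card_ord -[X in Num.sqrt X]mulr_natl expr_div_n sqr_sqrtr ?ler0n//.
by rewrite mulrCA mulfV ?gt_eqF// mulr1 sqrtr_sqr ger0_norm// ltW.
Qed.

Lemma spike_height_sqr : spike_height ^+ 2 = n%:R * rho ^+ 2 / d%:R.
Proof. by rewrite /spike_height expr_div_n exprMn !sqr_sqrtr ?ler0n. Qed.

Lemma observation_spiked s z :
  observation n (spiked_signal s) z =
  observation n (zero_signal d) (tuple_shift (spike spike_height s) z).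
Proof.
have sn : Num.sqrt n%:R != 0 :> R by rewrite gt_eqF// sqrtr_gt0 ltr0n.
apply: eq_from_tnth => i; rewrite !tnth_mktuple add0r mulrDr addrC; congr (_ + _).
rewrite /spike /spike_height; case: ifP => _; first by rewrite -!mulrA mulKf.
by rewrite mulrN -!mulrA mulKf.
Qed.

Lemma measurable_observation (f : d.-tuple R) :
  measurable_fun setT (observation n f).
Proof.
apply/measurable_fun_tnthP => i; rewrite /comp/=.
under eq_fun do rewrite tnth_mktuple.
apply: measurable_funD => //; apply: measurable_funM => //.
exact: measurable_tnth.
Qed.

End spiked_signal.

Section real_inequalities.
Context {R : realType}.

Lemma powR_prod (I : finType) (F : I -> R) (p : R) : (forall i, 0 <= F i) ->
  (\prod_i F i) `^ p = \prod_i F i `^ p.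
Proof.
move=> F0.
suff [] : (\prod_i F i) `^ p = \prod_i F i `^ p /\ 0 <= \prod_i F i by [].
elim/big_ind2 : _ => [|x x' y y' [<- x0] [<- y0]|i _]; first by rewrite powR1.
  by rewrite powRM// mulr_ge0.
by [].
Qed.

(** A value above 4 is wanted, with room to spare for the mean of the product, which is slightly
    above 1. *)
Lemma powR_ge_cube (x : R) : 10 <= x -> 43 / 10 <= x `^ (2 / 3).
Proof.
move=> x10; have x0 : 0 <= x by lra.
have e : (x `^ (2 / 3)) ^+ 3 = x ^+ 2.
  by rewrite -powR_mulrn ?powR_ge0// -powRrM divfK// powR_mulrn.
have x100 : 10 ^+ 2 <= x ^+ 2 by rewrite lerXn2r ?nnegrE.
by rewrite -(@ler_pXn2r _ 3) ?nnegrE ?powR_ge0// e; lra.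
Qed.

Lemma powR_ge_sqrt (x : R) : 10 <= x -> 316 / 100 <= x `^ 2^-1.
Proof.
move=> x10; have x0 : 0 <= x by lra.
have e : (x `^ 2^-1) ^+ 2 = x.
  by rewrite -powR_mulrn ?powR_ge0// -powRrM mulVf// powRr1.
have k0 : 0 <= 316 / 100 :> R by lra.
rewrite -(ler_sqr k0 (powR_ge0 _ _)) e; lra.
Qed.

Lemma prod_le_exp_sum (I : finType) (F : I -> R) : (forall i, 0 <= F i) ->
  \prod_i F i <= expR (\sum_i (F i - 1)).
Proof.
move=> F0; rewrite expR_sum; apply: ler_prod => i _; rewrite F0/=.
by have := expR_ge1Dx (F i - 1); rewrite addrC subrK.
Qed.

End real_inequalities.

(** * Type II errors of the tests *)

Section testing.
Local Open Scope ereal_scope.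
Context {R : realType}.
Variables (alpha : R) (n m d : nat) (rho : R).
Hypotheses (alpha01 : (0 < alpha <= 10%:R^-1)%R) (n0 : (0 < n)%N) (m0 : (0 < m)%N)
  (d0 : (0 < d)%N) (rho0 : (0 < rho)%R).
Hypothesis rate : (m%:R * d%:R * (n%:R * rho ^+ 2 / d%:R) ^+ 2 <= 100^-1 ^+ 2)%R.

Let a : R := spike_height n d rho.

Let alphaV : (10 <= alpha^-1)%R.
Proof.
by case/andP: alpha01 => al0 al1; rewrite -[leLHS]invrK lef_pV2// posrE ?invr_gt0.
Qed.

Let mR : (0 < m%:R :> R)%R. Proof. by rewrite ltr0n. Qed.

Let moment : (m%:R * (third_moment (a ^+ 2) d - 1) <= 500^-1)%R.
Proof.
apply: third_moment_le => //; first exact: sqr_ge0.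
by rewrite /a spike_height_sqr.
Qed.

Context dO (Omega : measurableType dO) (P : probability Omega R).
Variable Z : 'I_m -> {RV P >-> d.-tuple R}.
Hypothesis gZ : forall j, standard_gaussian (Z j).

Section separate_auxiliary_variables.
Context (dU : 'I_m -> measure_display) (TU : forall j, measurableType (dU j)).
Variables (U : forall j, {RV P >-> TU j})
  (e : forall j, {mfun (d.-tuple R * TU j)%type >-> R}).
Let E f j w := @e j (observation n f (Z j w), @U j w).
Hypothesis ZU : forall j A B, measurable A -> measurable B ->
  P (Z j @^-1` A `&` @U j @^-1` B) = P (Z j @^-1` A) * P (@U j @^-1` B).
Hypothesis e0 : forall j x, (0 <= @e j x)%R.
Hypothesis evE : forall j, is_evalue P (E (zero_signal d) j).

Let g j (x : d.-tuple R * TU j) : R := @e j (observation n (zero_signal d) x.1, x.2).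

Let mg j : measurable_fun setT (@g j).
Proof.
apply: measurableT_comp; first exact: measurable_funP.
apply: measurable_fun_pair => //.
by apply: measurableT_comp => //; exact: measurable_observation.
Qed.

Let g1 j : \int[P]_w (@g j (Z j w, @U j w))%:E <= 1.
Proof. by have [_] := evE j; rewrite unlock. Qed.

Let Eg s j w : E (spiked_signal rho s) j w =
  @g j (tuple_shift (spike a s) (Z j w), @U j w).
Proof. by rewrite /E /g/= (observation_spiked _ n0). Qed.

Let mE f j : measurable_fun setT (E f j).
Proof.
apply: measurableT_comp; first exact: measurable_funP.
apply: measurable_fun_pair; last exact: measurable_funP.
apply: measurableT_comp; first exact: measurable_observation.
exact: measurable_funP.
Qed.

Let mshift s j :
  measurable_fun setT (fun w => (tuple_shift (spike a s) (Z j w), @U j w)).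
Proof.
apply: measurable_fun_pair; last exact: measurable_funP.
apply: measurableT_comp; first exact: measurable_tuple_shift.
exact: measurable_funP.
Qed.

(* Truncating at [10 m] does not affect whether the average reaches [10]. *)
Lemma average_type_II_error : (3 / 4)%:E <= worst_type_II_error P alpha average rho E.
Proof.
pose y j x : R := Num.min (@g j x) (10 * m%:R)%R.
have y0 j x : (0 <= y j x)%R by rewrite /y le_min; apply/andP; split; [exact: e0|exact: mulr_ge0].
have my j : measurable_fun setT (y j) by exact: measurable_minr.
have ym j x : (y j x <= 10 * m%:R)%R by rewrite /y ge_min lexx orbT.
have yg j x : (y j x <= @g j x)%R by rewrite /y ge_min lexx.
(* By AM-GM and [y <= 10 m], [y (l - 1) <= y / 2 + 5 m (l - 1)^2]; then [l (l - 1)^2 >= 0] trades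
   [l^2] for [(l^3 + l) / 2]. The coefficients of [m] satisfy [5/2 + 5 = 15/2], so with [T] the
   third moment the mean is at most [3/2 + 5/2 m (T - 1) <= 5/2]. *)
have ylg j x l : (0 <= l)%R -> (y j x * l + 15 / 2 * m%:R * l <=
    3 / 2 * @g j x + 5 / 2 * m%:R * l ^+ 3 + 5 * m%:R)%R.
  move=> l0; have := y0 j x; have := ym j x; have := yg j x.
  move: (y j x) (@g j x) (m%:R : R) mR => Y G M M0 YG YM Y0.
  have h1 : (Y * (l - 1) <= Y / 2 + 5 * M * (l - 1) ^+ 2)%R.
    rewrite -(ler_pM2l M0); have := sqr_ge0 (Y - 10 * M * (l - 1)); nra.
  have h2 : (0 <= M * ((l - 1) ^+ 2 * l))%R.
    by apply: mulr_ge0; [exact: ltW|apply: mulr_ge0 => //; exact: sqr_ge0].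
  nra.
have p1 : (0 <= 15 / 2 * m%:R :> R)%R by move: mR; lra.
have p2 : (0 <= 3 / 2 :> R)%R by lra.
have p3 : (0 <= 5 / 2 * m%:R :> R)%R by move: mR; lra.
have p4 : (0 <= 5 * m%:R :> R)%R by move: mR; lra.
have [c Hc] : exists c : 'I_m -> cube d -> R, forall j,
    (forall s, \int[P]_w (y j (tuple_shift (spike a s) (Z j w), @U j w))%:E = (c j s)%:E) /\
    (cube_avg (c j) <= 5 / 2)%R.
  have H j : exists cj : cube d -> R,
    (forall s, \int[P]_w (y j (tuple_shift (spike a s) (Z j w), @U j w))%:E = (cj s)%:E) /\
    (cube_avg cj <= 5 / 2)%R.
    have [cj [h1 h2]] := mixture_mean_le (gZ j) (@ZU j) a (my j) (y0 j) (@mg j) (fun x => e0 _)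
      (g1 j) p1 p2 p3 p4 (ylg j).
    exists cj; split => //; apply: le_trans h2 _.
    by move: moment; lra.
  by exists (fun j => sval (cid (H j))) => j; exact: (svalP (cid (H j))).
have [s hs] := cube_avg_exists (fun s => \sum_j c j s)%R.
have cs : (\sum_j c j s <= m%:R * (5 / 2))%R.
  apply: (le_trans hs); rewrite cube_avg_sum.
  rewrite -[X in (X%:R * _)%R](card_ord m) mulr_natl -sumr_const.
  by apply: ler_sum => j _; have [] := Hc j.
rewrite (_ : 3 / 4 = 1 - 1 / 4)%R; last by field.
have mS : measurable [set w | (alpha^-1 <= combine average
    (fun j => E (spiked_signal rho s) j w))%R].
  by apply: measurable_ge_event; exact: measurable_combine.
apply: (worst_type_II_error_ge (f := spiked_signal rho s)) => //.
  exact: spiked_signal_H.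
have M0 : (0 < 10 * m%:R :> R)%R by rewrite mulr_gt0.
rewrite -(@lee_pmul2l _ (10 * m%:R)%:E)//.
apply: (@le_trans _ _ (\int[P]_w
    (\sum_j (y j (tuple_shift (spike a s) (Z j w), @U j w))%:E))).
  apply: markov_event => //.
  - apply: emeasurable_sum => j; apply/measurable_EFinP.
    exact: (measurableT_comp (my j) (@mshift s j)).
  - by move=> w; apply: sume_ge0 => j _; rewrite lee_fin.
  - move=> w /= Sw; rewrite sumEFin lee_fin.
    have {}Sw : (10 * m%:R <= \sum_j @g j (tuple_shift (spike a s) (Z j w), @U j w))%R.
      have := le_trans alphaV Sw; rewrite ler_pdivlMl// mulrC.
      by under eq_bigr do rewrite Eg.
    (* A single truncated value already equals [10 m]; if there is none, no e-value has been
       changed. *)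
    have [/existsP[j jm]|/existsPn jm] := boolP [exists j,
        (10 * m%:R <= @g j (tuple_shift (spike a s) (Z j w), @U j w))%R].
      rewrite (bigD1 j)//= {1}/y min_r// lerDl sumr_ge0// => i _.
    apply: (le_trans Sw); apply: ler_sum => j _.
    by rewrite /y le_min lexx/= ltW// ltNge.
rewrite ge0_integral_sum//; last 2 first.
- move=> j; apply/measurable_EFinP.
  exact: (measurableT_comp (my j) (@mshift s j)).
- by move=> j w _; rewrite lee_fin.
under eq_bigr do rewrite (proj1 (Hc _)).
rewrite sumEFin -EFinM lee_fin; apply: (le_trans cs); lra.
Qed.

(* The power [2 / 3] satisfies [3 l y^2 <= 2 y^3 + l^3], and [10^(2/3) > 4]. *)
Lemma product_type_II_error : mutually_independent Z U ->
  (3 / 4)%:E <= worst_type_II_error P alpha product rho E.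
Proof.
move=> indep.
pose y j x : R := (@g j x `^ (2 / 3))%R.
have y0 j x : (0 <= y j x)%R by exact: powR_ge0.
have my j : measurable_fun setT (y j).
  exact: (measurableT_comp (measurable_powR _) (@mg j)).
have ylg j x l : (0 <= l)%R ->
    (y j x * l + 0 * l <= 2 / 3 * @g j x + 1 / 3 * l ^+ 3 + 0)%R.
  move=> l0; have gx : (0 <= @g j x)%R by exact: e0.
  pose z := (@g j x `^ (3^-1))%R; have z0 : (0 <= z)%R by exact: powR_ge0.
  have -> : (@g j x = z ^+ 3)%R.
    by rewrite /z -powR_mulrn ?powR_ge0// -powRrM mulVf// powRr1.
  have -> : (y j x = z ^+ 2)%R.
    by rewrite /z /y -powR_mulrn ?powR_ge0// -powRrM mulrC.
  have : (0 <= (z - l) ^+ 2 * (2 * z + l))%R.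
    by apply: mulr_ge0; [exact: sqr_ge0|lra].
  nra.
have p2 : (0 <= 2 / 3 :> R)%R by lra.
have p3 : (0 <= 1 / 3 :> R)%R by lra.
have [c Hc] : exists c : 'I_m -> cube d -> R, forall j,
    (forall s, \int[P]_w (y j (tuple_shift (spike a s) (Z j w), @U j w))%:E = (c j s)%:E) /\
    (cube_avg (c j) <= 2 / 3 + 1 / 3 * third_moment (a ^+ 2) d)%R.
  have H j : exists cj : cube d -> R,
    (forall s, \int[P]_w (y j (tuple_shift (spike a s) (Z j w), @U j w))%:E = (cj s)%:E) /\
    (cube_avg cj <= 2 / 3 + 1 / 3 * third_moment (a ^+ 2) d)%R.
    have [cj [h1 h2]] := mixture_mean_le (gZ j) (@ZU j) a (my j) (y0 j) (@mg j) (fun x => e0 _)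
      (g1 j) (lexx 0%R) p2 p3 (lexx 0%R) (ylg j).
    by exists cj; split => //; apply: le_trans h2 _; rewrite addr0 subr0.
  by exists (fun j => sval (cid (H j))) => j; exact: (svalP (cid (H j))).
have c0 j s : (0 <= c j s)%R.
  by rewrite -lee_fin -(proj1 (Hc j)); apply: integral_ge0 => w _; rewrite lee_fin.
have [s hs] := cube_avg_exists (fun s => \sum_j c j s)%R.
have cs : (\sum_j c j s <= m%:R * (2 / 3 + 1 / 3 * third_moment (a ^+ 2) d))%R.
  apply: (le_trans hs); rewrite cube_avg_sum.
  rewrite -[X in (X%:R * _)%R](card_ord m) mulr_natl -sumr_const.
  by apply: ler_sum => j _; have [] := Hc j.
have cprod : (\prod_j c j s <= 43 / 10 * (1 / 4))%R.
  apply: le_trans (prod_le_exp_sum (fun j => c0 j s)) _.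
  rewrite sumrB sumr_const card_ord.
  (* The sum exceeds [m] by at most [m (T - 1) / 3], where [T] is the third moment and
     [m (T - 1) <= 1/500]. *)
  have h : (\sum_j c j s - 1 *+ m <= 1 / 1500)%R by move: moment; lra.
  rewrite -ler_expR in h; apply: (le_trans h).
  by apply: le_trans (expR_le_quadratic _) _; lra.
rewrite (_ : 3 / 4 = 1 - 1 / 4)%R; last by field.
have mS : measurable [set w | (alpha^-1 <= combine product
    (fun j => E (spiked_signal rho s) j w))%R].
  by apply: measurable_ge_event; exact: measurable_combine.
apply: (worst_type_II_error_ge (f := spiked_signal rho s)) => //.
  exact: spiked_signal_H.
have K0 : (0 < 43 / 10 :> R)%R by lra.
rewrite -(@lee_pmul2l _ (43 / 10)%:E)//.
have mys j : measurable_fun setT (fun w => y j (tuple_shift (spike a s) (Z j w), @U j w)).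
  exact: (measurableT_comp (my j) (@mshift s j)).
apply: (@le_trans _ _ (\int[P]_w
    (\prod_j y j (tuple_shift (spike a s) (Z j w), @U j w))%:E)).
  apply: markov_event => //.
  - by apply/measurable_EFinP; apply: measurable_prod => j _.
  - by move=> w; rewrite lee_fin prodr_ge0.
  - move=> w /= Sw; rewrite lee_fin -powR_prod; last by move=> j; exact: e0.
    apply: powR_ge_cube; apply: (le_trans alphaV); apply: (le_trans Sw).
    by under eq_bigr do rewrite Eg.
rewrite (independent_pairs_expectation_prod indep
  (h := fun j x => y j (tuple_shift (spike a s) x.1, x.2))).
- under eq_bigr do rewrite (proj1 (Hc _)).
  by rewrite prodEFin -EFinM lee_fin.
- move=> j; apply: measurableT_comp => //; apply: measurable_fun_pair => //.
  by apply: measurableT_comp => //; exact: measurable_tuple_shift.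
- by move=> j x; exact: y0.
- by move=> j; rewrite (proj1 (Hc j)) ltry.
Qed.

End separate_auxiliary_variables.
Section common_auxiliary_variable.
Hypothesis linear_rate : (m%:R * (n%:R * rho ^+ 2 / d%:R) <= 50^-1)%R.
Context (dU : measure_display) (TU : measurableType dU) (U : {RV P >-> TU})
  (e : 'I_m -> {mfun (d.-tuple R * TU)%type >-> R}).
Let E f j w := e j (observation n f (Z j w), U w).
Hypothesis indep : mutually_independent Z (fun _ : unit => U).
Hypothesis e0 : forall j x, (0 <= e j x)%R.
Hypothesis evE : forall j, is_evalue P (E (zero_signal d) j).
Hypothesis evprod :
  is_evalue P (fun w => combine product (fun j => E (zero_signal d) j w)).

Let g j (x : d.-tuple R * TU) : R := e j (observation n (zero_signal d) x.1, x.2).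

Let g0 j x : (0 <= g j x)%R. Proof. exact: e0. Qed.

Let mg j : measurable_fun setT (g j).
Proof.
apply: measurableT_comp; first exact: measurable_funP.
apply: measurable_fun_pair => //.
by apply: measurableT_comp => //; exact: measurable_observation.
Qed.

Let Eg s j w : E (spiked_signal rho s) j w =
  g j (tuple_shift (spike a s) (Z j w), U w).
Proof. by rewrite /E /g/= (observation_spiked _ n0). Qed.

Let mE f j : measurable_fun setT (E f j).
Proof.
apply: measurableT_comp; first exact: measurable_funP.
apply: measurable_fun_pair; last exact: measurable_funP.
apply: measurableT_comp; first exact: measurable_observation.
exact: measurable_funP.
Qed.

(** The noises of all machines as one variable independent of [U], so that [U] can be frozen for all
    of them simultaneously. *)
Let X w : m.-tuple (d.-tuple R) := [tuple Z j w | j < m].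

Let mX : measurable_fun setT X.
Proof.
apply/measurable_fun_tnthP => j; rewrite /comp/=.
under eq_fun do rewrite tnth_mktuple.
exact: measurable_funP.
Qed.

Let mU : measurable_fun setT U. Proof. exact: measurable_funP. Qed.

Let XU A B : @box _ (d.-tuple R) m A -> measurable B ->
  P (X @^-1` A `&` U @^-1` B) = P (X @^-1` A) * P (U @^-1` B).
Proof.
move=> [C mC ->] mB.
have XE : X @^-1` [set t | forall j, C j (tnth t j)] =
    [set w | forall j, C j (Z j w)].
  by apply/seteqP; split => w h j; have := h j; rewrite /= tnth_mktuple.
rewrite XE (mutually_independentl indep)//.
have := indep mC (fun=> mB).
rewrite [X in _ * X](big_pred1 tt)//= => <-; congr (P _).
by apply/seteqP; split => [w [h1 h2]|w [h1 h2]]; split => //; exact: (h2 tt).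
Qed.

Let ZUj j A B : measurable A -> measurable B ->
  P (Z j @^-1` A `&` U @^-1` B) = P (Z j @^-1` A) * P (U @^-1` B).
Proof. exact: (mutually_independent_pair indep (j := tt)). Qed.

Let mtuple_section (u : TU) j : measurable_fun setT (fun z => g j (z, u)).
Proof. by apply: measurableT_comp => //; exact: measurable_pair2. Qed.

(** For frozen [u] the machines are independent and the square of the left-hand side is at most
    [(1001/1000)^2] times the product of the [r j]. Replacing the square root of this product by
    [(1 + product) / 2] makes the bound linear in the conditional null mean, so that it can be
    integrated over [U]. *)
Let conditional_bound (u : TU) :
  (forall j, \int[P]_w (g j (Z j w, u))%:E \is a fin_num) ->
  \int[P]_w (cube_avg (fun s => \prod_j
     g j (tuple_shift (spike a s) (tnth (X w) j), u) `^ 2^-1)%R)%:E <=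
  (1001 / 2000)%:E * (1 + \int[P]_w (\prod_j g j (tnth (X w) j, u))%:E).
Proof.
move=> gfin; pose r j := fine (\int[P]_w (g j (Z j w, u))%:E).
have gr j : \int[P]_w (g j (Z j w, u))%:E = (r j)%:E by rewrite /r fineK.
have H j := mixture_sqrt_mean (gZ j) a (@mtuple_section u j) (fun z => g0 _ _) (gr j).
pose G j := sval (cid (H j)).
have GE j s : \int[P]_w (g j (tuple_shift (spike a s) (Z j w), u) `^ 2^-1)%:E = (G j s)%:E.
  by rewrite /G; case: cid => ? [].
have G0 j s : (0 <= G j s)%R by rewrite /G; case: cid => ? [].
have GQ j q : (forall s, (0 <= q s)%R) -> (cube_avg (fun s => q s * G j s) ^+ 2 <=
    r j * cube_form (expR (a ^+ 2)) (expR (- a ^+ 2)) q q)%R.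
  by move=> q0; have [_ _ h] := svalP (cid (H j)); exact: h.
have r0 j : (0 <= r j)%R.
  by rewrite fine_ge0//; apply: integral_ge0 => w _; rewrite lee_fin.
have mT : @measurable _ (d.-tuple R) = <<s measurable >>.
  exact: measurable_sigma_algebraE.
have indepZ := @independent_expectation_prod _ _ _ P _ _ (fun _ : 'I_m => d.-tuple R)
  (fun j w => Z j w) (fun j => @measurable_funP _ _ _ _ _ (Z j)) (fun=> measurable) (fun=> mT)
  (fun _ A B => @measurableI _ _ A B) (fun=> measurableT)
  (fun A mA => mutually_independentl indep mA).
have prodg : \int[P]_w (\prod_j g j (tnth (X w) j, u))%:E = (\prod_j r j)%:E.
  under eq_integral do under eq_bigr do rewrite tnth_mktuple.
  rewrite (indepZ (fun j z => g j (z, u)))//.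
  - by rewrite -prodEFin; apply: eq_bigr => j _; exact: gr.
  - by move=> j; rewrite [X in X < _]gr ltry.
have mshiftj j s : measurable_fun setT (fun z => (g j (tuple_shift (spike a s) z, u) `^ 2^-1)%R).
  apply: (measurableT_comp (measurable_powR _)).
  exact: (measurableT_comp (@mtuple_section u j) (@measurable_tuple_shift _ _ _)).
have prodG s : \int[P]_w (\prod_j
    (g j (tuple_shift (spike a s) (tnth (X w) j), u) `^ 2^-1))%R%:E = (\prod_j G j s)%:E.
  under eq_integral do under eq_bigr do rewrite tnth_mktuple.
  rewrite (indepZ (fun j z => (g j (tuple_shift (spike a s) z, u) `^ 2^-1)%R))//.
  - by rewrite -prodEFin; apply: eq_bigr => j _; exact: GE.
  - by move=> j z; exact: powR_ge0.
  - by move=> j; rewrite [X in X < _]GE ltry.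
have mtn j : measurable_fun setT (fun w => tnth (X w) j).
  exact: (measurableT_comp (@measurable_tnth _ _ m j) mX).
rewrite (cube_avg_integral _ _ prodG); last 2 first.
- move=> s; apply: measurable_prod => j _.
  exact: (measurableT_comp (@mshiftj j s) (@mtn j)).
- by move=> s w; rewrite prodr_ge0// => j _; exact: powR_ge0.
rewrite prodg -EFinD -EFinM lee_fin.
(* The constant statistic 1 has mean 1 under every signal; for it [mixture_sqrt_mean] says that the
   form dominates the squared average of [q]. *)
have one_int : \int[P]_w ((fun=> 1%R) (Z (Ordinal m0) w) : R)%:E = 1%:E.
  by rewrite integral_cst// mul1e; exact: probability_setT.
have [G1 [G1E _ G1Q]] := mixture_sqrt_mean (gZ (Ordinal m0)) a (measurable_cst (1%R : R))
  (fun=> ler01) one_int.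
have G11 s : G1 s = 1%R.
  apply: EFin_inj; rewrite -G1E -one_int.
  by apply: eq_integral => w _; rewrite powR1.
have form_ge (q : cube d -> R) : (forall s, (0 <= q s)%R) -> (cube_avg q ^+ 2 <=
    cube_form (expR (a ^+ 2)) (expR (- a ^+ 2)) q q)%R.
  move=> q0; have := G1Q q q0; rewrite mul1r; under eq_cube_avg do rewrite G11 mulr1.
  by [].
have a2 : (0 <= a ^+ 2)%R by exact: sqr_ge0.
have a2E : (a ^+ 2 = n%:R * rho ^+ 2 / d%:R)%R by rewrite /a spike_height_sqr.
have kmp : (expR (- a ^+ 2) <= expR (a ^+ 2))%R by rewrite ler_expR; lra.
have kp_km : (expR (a ^+ 2) - expR (- a ^+ 2) <=
    m%:R^-1 / 8 * (expR (a ^+ 2) + expR (- a ^+ 2)))%R.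
  by apply: sinh_le_cosh => //; rewrite a2E.
have := cube_avg_prod_le m0 (expR_ge0 _) kmp kp_km G0 r0 form_ge GQ.
have kappa : (((expR (a ^+ 2) + expR (- a ^+ 2)) / 2) ^+ (d * m.+1) <= (1001 / 1000) ^+ 2)%R.
  by apply: cosh_moment_le => //; rewrite a2E.
have A0 : (0 <= cube_avg (fun s => \prod_j G j s))%R.
  by apply: cube_avg_ge0 => s; rewrite prodr_ge0.
have rr0 : (0 <= \prod_j r j)%R by rewrite prodr_ge0.
move: (cube_avg _) (\prod_j r j)%R (_ ^+ (d * m.+1))%R A0 rr0 kappa => A r' K A0 rr0 kappa AK.
have AK' : (A ^+ 2 <= (1001 / 2000 * (1 + r')) ^+ 2)%R.
  by have := ler_wpM2r rr0 kappa; have := sqr_ge0 (1 - r')%R; nra.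
have B0 : (0 <= 1001 / 2000 * (1 + r'))%R by lra.
by rewrite -(ler_sqr A0 B0).
Qed.

(** The signal is chosen only after averaging over [U] and over the prior. The averaged mean of the
    square root is at most [1001/2000 (1 + 1)], and Markov's inequality at [316/100 < sqrt 10] gives
    [1001/3160]. *)
Lemma product_type_II_error_common :
  (1 - 1001 / 3160)%:E <= worst_type_II_error P alpha product rho E.
Proof.
pose h1 (x : m.-tuple (d.-tuple R) * TU) : \bar R := (cube_avg (fun s => \prod_j
  g j (tuple_shift (spike a s) (tnth x.1 j), x.2) `^ 2^-1)%R)%:E.
pose h2 (x : m.-tuple (d.-tuple R) * TU) : \bar R :=
  (\prod_j g j (tnth x.1 j, x.2))%:E.
have mt j : measurable_fun setT (fun x : m.-tuple (d.-tuple R) * TU => tnth x.1 j).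
  exact: (measurableT_comp (@measurable_tnth _ _ m j) measurable_fst).
have mh1 : measurable_fun setT h1.
  apply/measurable_EFinP; apply: measurable_funM => //.
  apply: measurable_sum => s; apply: measurable_prod => j _.
  apply: (measurableT_comp (measurable_powR _)).
  apply: (measurableT_comp (@mg j)); apply: measurable_fun_pair => //.
  exact: (measurableT_comp (@measurable_tuple_shift _ _ _) (@mt j)).
have mh2 : measurable_fun setT h2.
  apply/measurable_EFinP; apply: measurable_prod => j _.
  by apply: (measurableT_comp (@mg j)); apply: measurable_fun_pair.
have h10 x : 0 <= h1 x.
  rewrite lee_fin; apply: cube_avg_ge0 => s; rewrite prodr_ge0// => j _.
  exact: powR_ge0.
have h20 x : 0 <= h2 x by rewrite lee_fin prodr_ge0.
have I1 := independent_pair_integral mX mU (@measurable_tupleE _ _ m)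
  (@setI_closed_box _ _ m) (@box_setT _ _ m) XU mh1 h10.
have I2 := independent_pair_integral mX mU (@measurable_tupleE _ _ m)
  (@setI_closed_box _ _ m) (@box_setT _ _ m) XU mh2 h20.
have mI1 := measurable_independent_pair_integral P mX mU mh1 h10.
have mI2 := measurable_independent_pair_integral P mX mU mh2 h20.
have I2_le1 : \int[P]_w h2 (X w, U w) <= 1.
  have [_] := evprod; rewrite unlock; apply: le_trans.
  rewrite le_eqVlt; apply/orP; left; apply/eqP; apply: eq_integral => w _.
  by congr EFin; apply: eq_bigr => j _; rewrite tnth_mktuple.
(* Conditional null means integrate to at most 1 over [U], so they are finite almost surely, which
   is all that the comparison of integrals requires. *)
have gfin : {ae P, forall w, forall j, \int[P]_w' (g j (Z j w', U w))%:E \is a fin_num}.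
  have mT : @measurable _ (d.-tuple R) = <<s measurable >>.
    exact: measurable_sigma_algebraE.
  have GI : setI_closed (@measurable _ (d.-tuple R)) by move=> A B; exact: measurableI.
  apply: filter_forall => j.
  have mZ : measurable_fun setT (Z j) by exact: measurable_funP.
  have mgj : measurable_fun setT (EFin \o g j) by exact/measurable_EFinP.
  have gj0 x : 0 <= (EFin \o g j) x by rewrite lee_fin.
  have Ig := independent_pair_integral mZ mU mT GI measurableT (@ZUj j) mgj gj0.
  have mIg := measurable_independent_pair_integral P mZ mU mgj gj0.
  have [_] := evE j; rewrite unlock => g1.
  have Ig0 w : 0 <= \int[P]_w' (g j (Z j w', U w))%:E.
    by apply: integral_ge0 => w' _; rewrite lee_fin.
  have int : P.-integrable setT (fun w => \int[P]_w' (g j (Z j w', U w))%:E).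
    apply/integrableP; split => //.
    under eq_integral => w _ do rewrite gee0_abs//.
    rewrite -Ig; apply: (@le_lt_trans _ _ 1); last exact: ltry.
    exact: g1.
  have := integrable_ae measurableT int; apply: filterS => w; exact.
have A10 w : setT w -> 0 <= \int[P]_w' h1 (X w', U w).
  by move=> _; exact: integral_ge0.
have A20 w : setT w -> 0 <= \int[P]_w' h2 (X w', U w).
  by move=> _; exact: integral_ge0.
have mA2 : measurable_fun setT (fun w => 1 + \int[P]_w' h2 (X w', U w)).
  exact: emeasurable_funD.
have A20' w : setT w -> 0 <= 1 + \int[P]_w' h2 (X w', U w).
  by move=> wT; exact: adde_ge0 lee01 (A20 w wT).
have k0 : 0 <= (1001 / 2000)%:E :> \bar R by rewrite lee_fin; lra.
have I1_le : \int[P]_w h1 (X w, U w) <= (1001 / 1000)%:E.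
  rewrite I1; apply: (@le_trans _ _ (\int[P]_w ((1001 / 2000)%:E *
      (1 + \int[P]_w' h2 (X w', U w))))).
    apply: (ae_ge0_le_integral measurableT A10 mI1).
    - by move=> w wT; exact: mule_ge0 k0 (A20' w wT).
    - exact: (emeasurable_funM (measurable_cst _) mA2).
    - by apply: filterS gfin => w gw _; exact: conditional_bound.
  rewrite ge0_integralZl// ge0_integralD//.
  rewrite -I2 integral_cst// mul1e [X in X + _](_ : _ = 1); last exact: probability_setT.
  apply: (@le_trans _ _ ((1001 / 2000)%:E * (1 + 1))).
    by rewrite lee_wpmul2l ?leeD2l// lee_fin; lra.
  by rewrite -EFinD -EFinM lee_fin; lra.
pose S s := [set w | (alpha^-1 <= combine product
    (fun j => E (spiked_signal rho s) j w))%R].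
have mS s : measurable (S s) by apply: measurable_ge_event; exact: measurable_combine.
pose p s := fine (P (S s)).
have pE s : P (S s) = (p s)%:E by rewrite /p fineK// fin_num_measure.
have avg_p : (cube_avg p <= 1001 / 3160)%R.
  have pint : \int[P]_w (cube_avg (fun s => \1_(S s) w : R))%:E = (cube_avg p)%:E.
    apply: (cube_avg_integral (F := fun s w => \1_(S s) w)).
    - by move=> s; exact: measurable_indic.
    - by move=> s w; rewrite indicE.
    - by move=> s; rewrite -pE -[X in P X]setIT; rewrite integral_indic.
  have m1 : measurable_fun setT (fun w => (cube_avg (fun s => \1_(S s) w : R))%:E).
    apply/measurable_EFinP; apply: measurable_funM => //.
    by apply: measurable_sum => s; exact: measurable_indic.
  have ind0 w : 0 <= (cube_avg (fun s => \1_(S s) w : R))%:E.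
    by rewrite lee_fin; apply: cube_avg_ge0 => s; rewrite indicE.
  have k'0 : 0 <= (316 / 100)%:E :> \bar R by rewrite lee_fin; lra.
  have : (316 / 100)%:E * (cube_avg p)%:E <= (1001 / 1000)%:E.
    apply: le_trans I1_le; rewrite -pint -ge0_integralZl//.
    have mh1XU : measurable_fun setT (fun w => h1 (X w, U w)).
      by apply: (measurableT_comp mh1); exact: measurable_fun_pair.
    apply: (ge0_le_integral P measurableT _ (emeasurable_funM (measurable_cst _) m1) mh1XU).
      by move=> w _; exact: mule_ge0 k'0 (ind0 w).
    - move=> w _; rewrite -EFinM lee_fin -cube_avgZ; apply: le_cube_avg => s.
      rewrite indicE; have [|_] := boolP (w \in S s); last first.
        by rewrite mulr0 prodr_ge0// => j _; exact: powR_ge0.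
      rewrite inE mulr1 -powR_prod => [Sw|j]; last exact: g0.
      apply: powR_ge_sqrt; apply: (le_trans alphaV); apply: (le_trans Sw).
      rewrite le_eqVlt; apply/orP; left; apply/eqP; apply: eq_bigr => j _.
      by rewrite Eg /= tnth_mktuple.
  by rewrite -EFinM lee_fin; lra.
have [s hs] := cube_avg_exists p.
apply: (worst_type_II_error_ge (f := spiked_signal rho s)) => //.
- exact: spiked_signal_H.
- exact: mS.
- by rewrite [leLHS]pE lee_fin; exact: le_trans avg_p.
Qed.

End common_auxiliary_variable.
End testing.

(* The hypothesis involving [M] is void for [average]. *)
Theorem lemma2 (R : realType) :
  ((exists2 c : R, 0 < c & forall M : R, local_randomness_bound average M c) /\
   (forall M : R, 0 < M ->
      exists2 c : R, 0 < c & local_randomness_bound product M c)) /\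
  ((exists2 c : R, 0 < c & forall M : R, shared_randomness_bound average M c) /\
   (forall M : R, 0 < M ->
      exists2 c : R, 0 < c & shared_randomness_bound product M c)).
Proof.
have c0 : 0 < 100^-1 :> R by rewrite invr_gt0.
split; split=> [|M _]; exists 100^-1 => //.
- move=> M alpha n m d rho al n0 m0 d0 rho0 hrate dO Omega P Z dU TU U e E gZ indep e0 evE _.
  have rate := sqrt_rate_le n0 m0 d0 hrate.
  apply: average_type_II_error => // j A B.
  exact: (mutually_independent_pair indep).
- move=> alpha n m d rho al n0 m0 d0 rho0 hrate dO Omega P Z dU TU U e E gZ indep e0 evE _.
  have rate := sqrt_rate_le n0 m0 d0 hrate.
  apply: product_type_II_error => // j A B.
  exact: (mutually_independent_pair indep).
- move=> M alpha n m d rho al n0 m0 d0 rho0 hrate dO Omega P Z dU TU U e E gZ indep e0 evE _ _.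
  have rate := sqrt_rate_le n0 m0 d0 hrate.
  apply: (@lt_le_trans _ _ (3 / 4)%:E); first by rewrite lte_fin; lra.
  (* The bound for averages treats one machine at a time, so the version with separate auxiliary
     variables applies with every [U j] taken to be [U]. *)
  apply: (@average_type_II_error R alpha n m d rho al n0 m0 d0 rho0 rate _ _ P Z
    gZ (fun=> dU) (fun=> TU) (fun=> U) e) => // j A B.
  exact: (mutually_independent_pair indep (j := tt)).
- move=> alpha n m d rho al n0 m0 d0 rho0 hrate dO Omega P Z dU TU U e E gZ indep e0 evE _ evprod.
  have rate := sqrt_rate_le n0 m0 d0 hrate.
  have lrate := shared_rate_linear n0 m0 d0 hrate.
  (* Strictly above [2/3], since [3 * 1001 < 3160]. *)
  apply: (@lt_le_trans _ _ (1 - 1001 / 3160)%:E); first by rewrite lte_fin; lra.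
  apply: product_type_II_error_common => //.
  exact: evprod.
Qed.
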